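(* Let $G$ be a planar graph of order $n \geq 456$, and let $\mathcal{H} = K_2 \nabla P_{n-2}$. Then $q(G) \leq q(\mathcal{H})$, with equality if and only if $G \cong \mathcal{H}$.
   Context: All graphs are finite, undirected and simple (no loops or multiple edges). The order of a graph is its number of vertices. For a graph $G$ with vertices $v_1,\dots,v_n$, the signless Laplacian matrix is $Q(G) = D(G) + A(G)$, where $D(G)$ is the diagonal matrix of vertex degrees and $A(G)$ is the adjacency matrix; $q(G)$ denotes the largest eigenvalue of $Q(G)$ (the signless Laplacian spectral radius). $K_2$ is the complete graph on 2 vertices and $P_{m}$ is the path on $m$ vertices. The join $G_1 \nabla G_2$ is obtained from the disjoint union of $G_1$ and $G_2$ by joining each vertex of $G_1$ to each vertex of $G_2$. *)

(* Defs.v *)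
From HB Require Import structures.
From mathcomp Require Import all_boot all_order all_algebra.
From mathcomp Require Import all_classical all_reals all_analysis.

Set Implicit Arguments.
Unset Strict Implicit.
Unset Printing Implicit Defensive.

Import Order.TTheory GRing.Theory Num.Theory.
Import numFieldNormedType.Exports.

Local Open Scope ring_scope.
Local Open Scope classical_set_scope.

Record sgraph := SGraph {
  vertex :> finType;
  adj : rel vertex;
  adj_sym : symmetric adj;
  adj_irrefl : irreflexive adj }.

Definition giso (G H : sgraph) : Prop :=
  exists f : G -> H, bijective f /\ forall x y, adj (f x) (f y) = adj x y.

Section Complete.
Variable n : nat.
Definition complete_adj : rel 'I_n := fun i j => i != j.
Lemma complete_sym : symmetric complete_adj.
Proof. by move=> i j; rewrite /complete_adj eq_sym. Qed.
Lemma complete_irrefl : irreflexive complete_adj.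
Proof. by move=> i; rewrite /complete_adj eqxx. Qed.
Definition complete_graph := SGraph complete_sym complete_irrefl.
End Complete.

Section PathGraph.
Variable n : nat.
Definition path_adj : rel 'I_n :=
  fun i j => (i.+1 == j :> nat) || (j.+1 == i :> nat).
Lemma path_sym : symmetric path_adj.
Proof. by move=> i j; rewrite /path_adj orbC. Qed.
Lemma path_irrefl : irreflexive path_adj.
Proof. by move=> i; rewrite /path_adj orbb gtn_eqF. Qed.
Definition path_graph := SGraph path_sym path_irrefl.
End PathGraph.

Section Join.
Variables G H : sgraph.
Definition join_adj : rel (G + H)%type := fun x y =>
  match x, y with
  | inl a, inl b => adj a b
  | inr a, inr b => adj a b
  | _, _ => true
  end.
Lemma join_sym : symmetric join_adj.
Proof. by move=> [a|a] [b|b] //=; rewrite adj_sym. Qed.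
Lemma join_irrefl : irreflexive join_adj.
Proof. by move=> [a|a] /=; rewrite adj_irrefl. Qed.
Definition graph_join := SGraph join_sym join_irrefl.
End Join.

Section Spectral.
Variables (R : realType) (G : sgraph).

Definition degree (x : G) : nat := #|[pred y | adj x y]|.

Definition adjacency_mx : 'M[R]_#|G| :=
  \matrix_(i, j) (adj (enum_val i) (enum_val j))%:R.

Definition degree_mx : 'M[R]_#|G| :=
  diag_mx (\row_i (degree (enum_val i))%:R).

Definition signless_laplacian : 'M[R]_#|G| := degree_mx + adjacency_mx.

(* The matrix is real symmetric, so for a nonempty graph its set of real      *)
(* eigenvalues is finite and nonempty and the supremum is its maximum.        *)
Definition q_radius : R := sup [set a | eigenvalue signless_laplacian a].

End Spectral.

Section Planar.
Variable R : realType.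

Definition jordan_arc (a b : R * R) (A : set (R * R)) : Prop :=
  exists g : R -> R * R,
    [/\ {within `[0, 1], continuous g}, {in `[0, 1] &, injective g},
        g 0 = a, g 1 = b & A = g @` `[0, 1]].

(* [E x y] is only meaningful when [x] and [y] are adjacent; the edges [xy]   *)
(* and [yx] are the same, hence [E x y = E y x].                              *)
Record plane_drawing (G : sgraph) (p : G -> R * R)
    (E : G -> G -> set (R * R)) : Prop := PlaneDrawing {
  drawing_vertex_inj : injective p;
  drawing_edge_sym : forall x y, adj x y -> E x y = E y x;
  drawing_edge_arc : forall x y, adj x y -> jordan_arc (p x) (p y) (E x y);
  drawing_edge_vertex : forall x y z, adj x y ->
    E x y (p z) -> z = x \/ z = y;
  drawing_edge_edge : forall x y u v, adj x y -> adj u v ->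
    ~ (x = u /\ y = v) -> ~ (x = v /\ y = u) ->
    forall c, E x y c -> E u v c ->
    exists z, [/\ c = p z, z = x \/ z = y & z = u \/ z = v] }.

Definition planar (G : sgraph) : Prop :=
  exists (p : G -> R * R) (E : G -> G -> set (R * R)), plane_drawing p E.

End Planar.

(* Main.v *)
(* Planarity enters only through two consequences: a planar graph has no K_5    *)
(* minor and no K_{3,3} subgraph. Both follow from van Kampen's parity         *)
(* argument. Sampling the arcs finely and perturbing the sample points gives a *)
(* drawing by polygonal paths with vertices in general position, in which      *)
(* paths of independent edges still do not cross. In such a drawing of K_5 or  *)
(* K_{3,3} the parity of the number of crossings between independent edges     *)
(* does not change when a path is replaced by a segment, since a closed        *)
(* polygon meets another one an even number of times, and for straight         *)
(* segments this parity is odd. Only paths of independent edges need to be     *)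
(* disjoint, so for K_5 the paths may run through the branch sets of a minor.  *)
(*   Excluding K_5 minors gives a degree sum below 8n by contracting edges     *)
(* (Mader), and excluding K_{3,3} bounds all degrees but the two largest by    *)
(* (2n + 2) / 3. A test vector shows q(H) > n + 2, and if q(G) >= n + 2 the    *)
(* eigenvalue equations force two vertices of degree n - 1. What remains after *)
(* deleting them has no cycle (K_5) and no vertex of degree 3 (K_{3,3}), so G   *)
(* is a spanning subgraph of H, and Perron-Frobenius concludes.                *)

(* Topology. Only the orientation signs of point triples matter for crossing parities, so the parity
   argument is run on abstract sign systems ([chirotope]), where finite checks give odd parity for
   straight K_5 and K_{3,3}, and [independent_crossings_straight] carries it to polygonal paths. By
   [chains_meet], fine chains along the arcs of independent edges then come arbitrarily close,
   whereas disjoint compact arcs keep a positive distance ([drawing_separation]). This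
   contradiction, [drawing_no_odd_model], yields [planar_no_K5_model] and [planar_no_K33].

   Counting. [dense_clique_model] and [planar_no_K33] give the degree bounds [planar_degree_sum] and
   [planar_three_degrees].

   Spectrum. If q(G) >= q(H), then q(G) > n + 2 by [extremal_q_radius]. The two degree bounds leave
   room for this only when two vertices are adjacent to everything ([two_hubs]); forbidding K_5 and
   K_{3,3} turns the rest into disjoint paths, so G embeds in H as a spanning subgraph
   ([hubs_embedding]). Adding edges cannot decrease q, and strictly increases it when the Perron
   vector of H is positive ([q_radius_hom], [q_radius_hom_eq]). *)
Require Import Defs.
From Stdlib Require Import Ring.
From mathcomp Require Import all_boot all_order all_algebra.
From mathcomp Require Import all_classical all_reals all_analysis.

Set Implicit Arguments.
Unset Strict Implicit.
Unset Printing Implicit Defensive.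

(* MathComp's [ring], loaded below, does not know that [b (+) b = false].      *)
Add Ring bool_ring : BoolTheory (decidable bool_eq_ok, constants [bool_cst]).
Ltac bool_ring := ring.

From mathcomp Require Import ring lra zify.

(** * Crossing parity of polygonal drawings *)

Ltac split_ands := repeat match goal with
  | H : is_true (_ && _) |- _ => move/andP: H => [? ?] end.
Ltac split_uniq u := move: u; rewrite /= ?inE ?negb_or ?andbT => u; split_ands.
Ltac solve_uniq := rewrite /= ?inE ?negb_or ?andbT;
  repeat match goal with |- is_true (_ && _) => apply/andP; split end;
  first [assumption | by rewrite eq_sym].

Section Chirotope.
Variable I : eqType.

(* The sign rules satisfied by the orientations of a planar point set in      *)
(* general position: alternation, the affine relation                         *)
(* [bcd] - [acd] + [abd] - [abc] = 0 and the Grassmann-Pluecker relation      *)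
(* [abc][ade] - [abd][ace] + [abe][acd] = 0.                                  *)
Record chirotope (o : I -> I -> I -> bool) : Prop := Chirotope {
  ch_cyc : forall a b c, o b c a = o a b c;
  ch_anti : forall a b c, uniq [:: a; b; c] -> o b a c = ~~ o a b c;
  ch_affine : forall a b c d, uniq [:: a; b; c; d] ->
    ~~ [&& o b c d == ~~ o a c d, ~~ o a c d == o a b d
         & o a b d == ~~ o a b c];
  ch_plucker : forall a b c d e, uniq [:: a; b; c; d; e] ->
    ~~ [&& (o a b c == o a d e) == (o a b d != o a c e)
         & (o a b d != o a c e) == (o a b e == o a c d)] }.

Variable o : I -> I -> I -> bool.
Hypothesis ho : chirotope o.

Definition cross (a b c d : I) : bool :=
  (o a b c != o a b d) && (o c d a != o c d b).

Definition in_triangle (k l m a : I) : bool :=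
  (o k l a == o l m a) && (o l m a == o m k a).

Lemma crossC a b c d : cross c d a b = cross a b c d.
Proof. by rewrite /cross andbC. Qed.

Lemma sort3 a b c : uniq [:: a; b; c] ->
  [/\ o b c a = o a b c, o c a b = o a b c, o b a c = ~~ o a b c,
      o a c b = ~~ o a b c & o c b a = ~~ o a b c].
Proof.
move=> u; have e := ch_anti ho u.
have f : o a c b = ~~ o a b c by rewrite (ch_cyc ho b a c).
split=> //; first exact: ch_cyc.
- by rewrite (ch_cyc ho b c a) (ch_cyc ho).
- by rewrite (ch_cyc ho a c b).
Qed.

Ltac sort_triple a b c :=
  let H := fresh in
  (have [] : [/\ o b c a = o a b c, o c a b = o a b c, o b a c = ~~ o a b c,
      o a c b = ~~ o a b c & o c b a = ~~ o a b c]
    by apply: sort3; solve_uniq);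
  do 5 (let e := fresh in move=> e; rewrite ?e; clear e).

(* Ten orientation signs are attached to five points: a finite check.         *)
Ltac five_points a b k l m u :=
  split_uniq u;
  have := ch_affine ho (a := a) (b := b) (c := k) (d := l) ltac:(solve_uniq);
  have := ch_affine ho (a := a) (b := b) (c := k) (d := m) ltac:(solve_uniq);
  have := ch_affine ho (a := a) (b := b) (c := l) (d := m) ltac:(solve_uniq);
  have := ch_affine ho (a := a) (b := k) (c := l) (d := m) ltac:(solve_uniq);
  have := ch_affine ho (a := b) (b := k) (c := l) (d := m) ltac:(solve_uniq);
  have := ch_plucker ho (a := a) (b := b) (c := k) (d := l) (e := m)
    ltac:(solve_uniq);
  have := ch_plucker ho (a := b) (b := a) (c := k) (d := l) (e := m)
    ltac:(solve_uniq);
  have := ch_plucker ho (a := k) (b := a) (c := b) (d := l) (e := m)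
    ltac:(solve_uniq);
  have := ch_plucker ho (a := l) (b := a) (c := b) (d := k) (e := m)
    ltac:(solve_uniq);
  have := ch_plucker ho (a := m) (b := a) (c := b) (d := k) (e := l)
    ltac:(solve_uniq);
  rewrite /cross /in_triangle;
  sort_triple a b k; sort_triple a b l; sort_triple a b m;
  sort_triple a k l; sort_triple a k m; sort_triple a l m;
  sort_triple b k l; sort_triple b k m; sort_triple b l m;
  sort_triple k l m;
  move: (o a b k) (o a b l) (o a b m) (o a k l) (o a k m);
  move: (o a l m) (o b k l) (o b k m) (o b l m) (o k l m);
  do 10!case.

(** Jordan curve theorem for a triangle: a segment crosses the boundary an odd number of times
    exactly when one of its two ends is inside. *)
Lemma cross_triangle a b k l m : uniq [:: a; b; k; l; m] ->
  cross a b k l (+) cross a b l m (+) cross a b k m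
  = in_triangle k l m a (+) in_triangle k l m b.
Proof. by move=> u; five_points a b k l m u. Qed.

(** At most one of the three pairings of four points crosses, so the sum detects convex position. *)
Definition convex_quad a b c d : bool :=
  cross a b c d (+) cross a c b d (+) cross a d b c.

(** Five points span 1, 3 or 5 convex quadrilaterals, according to whether their hull is a triangle,
    a quadrilateral or a pentagon. Each pair of independent edges of K_5 lies in exactly one
    quadruple, so this is the crossing parity of straight K_5. *)
Lemma K5_odd a b c d e : uniq [:: a; b; c; d; e] ->
  convex_quad b c d e (+) convex_quad a c d e (+) convex_quad a b d e (+)
  convex_quad a b c e (+) convex_quad a b c d.
Proof. by move=> u; rewrite /convex_quad; five_points a b c d e u. Qed.

(** Apply [cross_triangle] to the three sides of abc: each vertex contributes its position relative
    to klm twice. *)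
Lemma triangles_even a b c k l m : uniq [:: a; b; c; k; l; m] ->
  (cross a b k l (+) cross a b l m (+) cross a b k m) (+)
  (cross b c k l (+) cross b c l m (+) cross b c k m) (+)
  (cross a c k l (+) cross a c l m (+) cross a c k m) = false.
Proof.
move=> u; split_uniq u; rewrite !cross_triangle; try solve_uniq.
by case: (in_triangle k l m a) (in_triangle k l m b) (in_triangle k l m c) => [] [] [].
Qed.

(** Add [K5_odd] for a1, a2, a3 and each two of the b's. Quadruples with three a's occur twice and
    cancel; crossings of an edge aa with an edge bb cancel by [triangles_even]; the crossings of
    K_{3,3} remain, with sum 1 + 1 + 1. *)
Lemma K33_odd a1 a2 a3 b1 b2 b3 : uniq [:: a1; a2; a3; b1; b2; b3] ->
  let X i j b b' := cross i b j b' (+) cross i b' j b in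
  let Y i j := X i j b1 b2 (+) X i j b1 b3 (+) X i j b2 b3 in
  Y a1 a2 (+) Y a1 a3 (+) Y a2 a3.
Proof.
move=> u.
have T := triangles_even u.
split_uniq u.
have H1 : uniq [:: a1; a2; a3; b1; b2] by solve_uniq.
have H2 : uniq [:: a1; a2; a3; b1; b3] by solve_uniq.
have H3 : uniq [:: a1; a2; a3; b2; b3] by solve_uniq.
have {H1} := K5_odd H1; have {H2} := K5_odd H2; have {H3} := K5_odd H3.
move: T.
have addE x y : x (+) y = xorb x y by case: x y => [] [].
rewrite /convex_quad /= !addE /is_true => E0 E1 E2 E3.
have K X L0 L1 L2 L3 : L0 = false -> L1 = true -> L2 = true -> L3 = true ->
  X = xorb (xorb L1 L2) (xorb L3 L0) -> X = true by move=> -> -> -> ->.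
by apply: (K _ _ _ _ _ E0 E1 E2 E3); bool_ring.
Qed.
End Chirotope.

Definition segments (T : Type) (x : T) (s : seq T) : seq (T * T) :=
  zip (x :: s) s.

Section PathCrossings.
Variables (I : eqType) (o : I -> I -> I -> bool).
Hypothesis ho : chirotope o.

Definition crossings x s y t : bool :=
  \big[addb/false]_(e <- segments x s) \big[addb/false]_(f <- segments y t)
    cross o e.1 e.2 f.1 f.2.

Lemma crossingsC x s y t : crossings x s y t = crossings y t x s.
Proof.
rewrite /crossings exchange_big; apply: eq_bigr => e _.
by apply: eq_bigr => f _; rewrite crossC.
Qed.

Lemma crossings_cons x z s y t :
  crossings x (z :: s) y t = crossings x [:: z] y t (+) crossings z s y t.
Proof. by rewrite /crossings /= big_cons big_cons big_nil addbF. Qed.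

Lemma crossings_nil x y t : crossings x [::] y t = false.
Proof. by rewrite /crossings big_nil. Qed.

Lemma crossings_seg a b c d : crossings a [:: b] c [:: d] = cross o a b c d.
Proof. by rewrite /crossings /= big_cons big_nil big_cons big_nil !addbF. Qed.

(** How often, mod 2, the cone with apex [z] over the path covers the point [a]. *)
Definition cone_parity z y t a : bool :=
  \big[addb/false]_(f <- segments y t) in_triangle o z f.1 f.2 a.

(** Sum [cross_triangle] over the triangles of the cone: inner spokes from [z] belong to two
    triangles and cancel, leaving the first and the last. *)
Lemma crossings_segment_path a b z y t : uniq [:: a, b, z, y & t] ->
  crossings a [:: b] y t = cone_parity z y t a (+) cone_parity z y t b (+)
    cross o a b z y (+) cross o a b z (last y t).
Proof.
elim: t y => [|m t IH] y u.
  rewrite crossingsC crossings_nil /cone_parity !big_nil /=.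
  by rewrite addbb.
rewrite crossingsC crossings_cons !(crossingsC _ _ a) crossings_seg IH; last first.
  apply: subseq_uniq u; apply: (@cat_subseq _ [:: a; b; z] (m :: t) [:: a; b; z]);
    by [rewrite subseq_refl | rewrite subseq_cons].
have u5 : uniq [:: a; b; z; y; m].
  apply: subseq_uniq u; rewrite /= !eqxx /= sub0seq //.
have := cross_triangle ho u5; rewrite /cone_parity /= !big_cons /=.
move: (\big[addb/false]_(_ <- _) _) (\big[addb/false]_(_ <- _) _) => p q.
by case: (in_triangle _ _ _ _ a) (in_triangle _ _ _ _ b) p q
  (cross o a b y m) (cross o a b z y) (cross o a b z m) (cross o a b z (last m t))
  => [] [] [] [] [] [] [] [].
Qed.

Lemma crossings_path_path x s z y t : uniq ((x :: s) ++ [:: z, y & t]) ->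
  crossings x s y t = cone_parity z y t x (+) cone_parity z y t (last x s) (+)
    crossings x s z [:: y] (+) crossings x s z [:: last y t].
Proof.
elim: s x => [|w s IH] x u.
  by rewrite !crossings_nil; case: cone_parity.
rewrite crossings_cons (crossings_segment_path (z := z)); last first.
  apply: subseq_uniq u; rewrite /= !eqxx.
  exact: suffix_subseq.
rewrite IH; last by case/andP: u.
rewrite [in RHS]crossings_cons [X in _ = _ (+) X]crossings_cons !crossings_seg /=.
move: (cone_parity _ _ _ x) (cone_parity _ _ _ w) (cone_parity _ _ _ (last w s)).
move: (cross o x w z y) (cross o x w z (last y t)).
by move: (crossings w s z [:: y]) (crossings w s z [:: last y t]);
  do 7!case.
Qed.

End PathCrossings.

Section VanKampen.
Variables (I : eqType) (o : I -> I -> I -> bool).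
Hypothesis ho : chirotope o.
Variables (E : seq (nat * nat)) (r : nat -> I) (S : nat * nat -> seq I) (z : I).

Definition indep (e f : nat * nat) : bool :=
  [&& e.1 != f.1, e.1 != f.2, e.2 != f.1 & e.2 != f.2].

Definition before (e f : nat * nat) : bool := index e E < index f E.

Definition independent_crossings (X : nat * nat -> nat * nat -> bool) : bool :=
  \big[addb/false]_(e <- E) \big[addb/false]_(f <- E | indep e f && before e f)
    X e f.

Hypothesis last_S : forall e, e \in E -> last (r e.1) (S e) = r e.2.
Hypothesis r_neq : forall e, e \in E -> r e.1 != r e.2.
Hypothesis uniq_S : forall e f, e \in E -> f \in E -> indep e f ->
  uniq ((r e.1 :: S e) ++ [:: z, r f.1 & S f]).
(** Every vertex has even degree in the graph of edges independent of [e]: a triangle for K_5, a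
    4-cycle for K_{3,3}. *)
Hypothesis closed : forall e (psi : nat -> bool), e \in E ->
  \big[addb/false]_(f <- E | indep e f) (psi f.1 (+) psi f.2) = false.

Lemma indepC e f : indep e f = indep f e.
Proof.
rewrite /indep ![f.1 == _]eq_sym ![f.2 == _]eq_sym.
by case: (e.1 == f.1) (e.1 == f.2) (e.2 == f.1) (e.2 == f.2) => [] [] [] [].
Qed.

Let line (e : nat * nat) := [:: r e.2].

(* The contributions of the segments joining the apex [z] to the endpoints of   *)
(* the edges cancel because the edges independent of [e] form a cycle.        *)
Lemma straighten_edge (H : nat * nat -> seq I) e : e \in E ->
  (forall f, H f = S f \/ H f = line f) ->
  \big[addb/false]_(f <- E | indep e f) crossings o (r e.1) (S e) (r f.1) (H f)
  = \big[addb/false]_(f <- E | indep e f)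
      crossings o (r e.1) (line e) (r f.1) (H f).
Proof.
move=> eE hH.
have sub g t : g \in E -> t = S g \/ t = line g -> subseq t (S g).
  move=> gE [->//|->]; rewrite sub1seq.
  have := last_S gE; have := r_neq gE.
  by case: (S g) => [/eqP //|x s] _ /= <-; apply: mem_last.
(* The right-hand side depends on the endpoints of [e] only, so both choices of its path give the
   same parity. The spokes [psi] have been cancelled by [closed]. *)
have main s : s = S e \/ s = line e ->
  \big[addb/false]_(f <- E | indep e f) crossings o (r e.1) s (r f.1) (H f)
  = \big[addb/false]_(f <- E | indep e f)
      (cone_parity o z (r f.1) (H f) (r e.1) (+)
       cone_parity o z (r f.1) (H f) (r e.2)).
  move=> hs; have ls : last (r e.1) s = r e.2 by case: hs => -> //; exact: last_S.
  pose psi v := crossings o (r e.1) s z [:: r v].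
  rewrite -[RHS]addbF -[X in _ = _ (+) X](closed psi eE).
  etransitivity; last exact: big_split.
  rewrite /= big_seq_cond [RHS]big_seq_cond.
  apply: eq_bigr => f /andP[fE ef].
  rewrite /psi.
  have -> : r f.2 = last (r f.1) (H f) by case: (hH f) => -> //; rewrite last_S.
  rewrite (crossings_path_path ho (z := z)) ?ls ?addbA //.
  apply: subseq_uniq (uniq_S eE fE ef); apply: cat_subseq; rewrite /= !eqxx;
    exact: sub.
by rewrite !main; [|right|left].
Qed.

(* The edges are straightened one at a time: [H e] is the drawing in which the *)
(* edges up to [e] are already straight.                                      *)
Theorem independent_crossings_straight :
  independent_crossings (fun e f => crossings o (r e.1) (S e) (r f.1) (S f)) =
  independent_crossings (fun e f => cross o (r e.1) (r e.2) (r f.1) (r f.2)).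
Proof.
rewrite /independent_crossings.
pose X s t (e f : nat * nat) := crossings o (r e.1) (s e) (r f.1) (t f).
have XC s t e f : X s t e f = X t s f e by apply: crossingsC.
have split_before Y e : e \in E ->
    \big[addb/false]_(f <- E | indep e f) Y f =
    \big[addb/false]_(f <- E | indep e f && before e f) Y f (+)
    \big[addb/false]_(f <- E | indep e f && before f e) Y f.
  move=> eE; rewrite (bigID (before e)) /=; congr addb.
  rewrite big_seq_cond [RHS]big_seq_cond; apply: eq_bigl => f.
  case fE : (f \in E) => //=; case ef: (indep e f) => //=.
  rewrite /before -leqNgt leq_eqVlt; case: eqP => // /(congr1 (nth e E)).
  by rewrite !nth_index // => fe; move: ef; rewrite fe /indep eqxx.
have flip (Y : nat * nat -> nat * nat -> bool) :
    \big[addb/false]_(e <- E) \big[addb/false]_(f <- E | indep e f && before f e) Y e f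
    = \big[addb/false]_(e <- E) \big[addb/false]_(f <- E | indep e f && before e f) Y f e.
  rewrite (exchange_big_dep xpredT) //=; apply: eq_bigr => e _.
  by apply: eq_bigl => f; rewrite indepC.
pose H e f := if before e f then S f else line f.
have step : \big[addb/false]_(e <- E) \big[addb/false]_(f <- E | indep e f)
     X S (H e) e f =
   \big[addb/false]_(e <- E) \big[addb/false]_(f <- E | indep e f)
     X line (H e) e f.
  rewrite big_seq [RHS]big_seq; apply: eq_bigr => e eE; apply: straighten_edge => // f.
  by rewrite /H; case: before; [left|right].
have expand s : \big[addb/false]_(e <- E) \big[addb/false]_(f <- E | indep e f)
     X s (H e) e f =
   \big[addb/false]_(e <- E) \big[addb/false]_(f <- E | indep e f && before e f) X s S e f (+)
   \big[addb/false]_(e <- E) \big[addb/false]_(f <- E | indep e f && before e f) X line s e f.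
  transitivity (\big[addb/false]_(e <- E)
      (\big[addb/false]_(f <- E | indep e f && before e f) X s S e f (+)
       \big[addb/false]_(f <- E | indep e f && before f e) X s line e f)).
    rewrite big_seq [RHS]big_seq; apply: eq_bigr => e eE.
    rewrite split_before //; congr addb; apply: eq_bigr => f /andP[_ ef].
      by rewrite /X /H ef.
    by rewrite /X /H /before ltnNge ltnW.
  rewrite big_split /= flip; congr addb.
  by apply: eq_bigr => e _; apply: eq_bigr => f _; rewrite XC.
(* The equation reads A + B = B + C, where A has both paths original, C both straight, and B one of
   each. *)
move: step; rewrite !expand.
set A := (X in X (+) _ = _); set B := (X in _ (+) X = _); set C := (X in _ = _ (+) X).
move=> AB; transitivity C; last first.
  by apply: eq_bigr => e _; apply: eq_bigr => f _; rewrite /C /X crossings_seg.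
change (A = C); change (A (+) B = B (+) C) in AB; move: AB.
by clearbody A B C; case: A B C => [] [] [].
Qed.
End VanKampen.

(* Graphs on {0, ..., k-1} for which the van Kampen obstruction applies.       *)
Record crossing_odd (E : seq (nat * nat)) (k : nat) : Prop := CrossingOdd {
  co_closed : forall e (psi : nat -> bool), e \in E ->
    \big[addb/false]_(f <- E | indep e f) (psi f.1 (+) psi f.2) = false;
  co_vertex : forall e, e \in E -> [&& e.1 != e.2, e.1 < k & e.2 < k];
  co_straight : forall (I : eqType) (o : I -> I -> I -> bool) (r : nat -> I),
    chirotope o -> uniq [seq r i | i <- iota 0 k] ->
    independent_crossings E
      (fun e f => cross o (r e.1) (r e.2) (r f.1) (r f.2)) }.

Definition K5_edges : seq (nat * nat) :=
  [:: (0, 1); (0, 2); (0, 3); (0, 4); (1, 2); (1, 3); (1, 4);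
      (2, 3); (2, 4); (3, 4)].

Definition K33_edges : seq (nat * nat) :=
  [:: (0, 3); (0, 4); (0, 5); (1, 3); (1, 4); (1, 5);
      (2, 3); (2, 4); (2, 5)].

Lemma K5_crossing_odd : crossing_odd K5_edges 5.
Proof.
split=> //.
- move=> e psi; suff /allP H : all (fun e => \big[addb/false]_(f <- K5_edges | indep e f)
      (psi f.1 (+) psi f.2) == false) K5_edges by move/H/eqP.
  rewrite unlock /=; by case: (psi 0) (psi 1) (psi 2) (psi 3) (psi 4) => [] [] [] [] [].
- by apply/allP.
- move=> I o r ho u; have := K5_odd ho u.
  rewrite /independent_crossings unlock /= /convex_quad.
  have addE x y : x (+) y = xorb x y by case: x y => [] [].
  by rewrite !addE /is_true => <-; bool_ring.
Qed.

Lemma K33_crossing_odd : crossing_odd K33_edges 6.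
Proof.
split=> //.
- move=> e psi; suff /allP H : all (fun e => \big[addb/false]_(f <- K33_edges | indep e f)
      (psi f.1 (+) psi f.2) == false) K33_edges by move/H/eqP.
  by rewrite unlock /=; case: (psi 0) (psi 1) (psi 2) (psi 3) (psi 4) (psi 5)
    => [] [] [] [] [] [].
- by apply/allP.
- move=> I o r ho u; have := K33_odd ho u.
  rewrite /independent_crossings unlock /=.
  have addE x y : x (+) y = xorb x y by case: x y => [] [].
  by rewrite !addE /is_true => <-; bool_ring.
Qed.

(** * Clique minors in dense graphs *)

Section CliqueModels.
Variable T : finType.
Implicit Types (e : rel T) (A N : {set T}).

Definition restrict_rel e (B : {set T}) : rel T := [rel x y | [&& x \in B, y \in B & e x y]].

Definition connected_in e (B : {set T}) : Prop :=
  {in B &, forall x y, connect (restrict_rel e B) x y}.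

(* A model of the clique on [r] vertices as a minor: branch sets               *)
(* [B 0, ..., B (r - 1)] inside [A].                                          *)
Record clique_model e A (r : nat) (B : nat -> {set T}) : Prop := CliqueModel {
  cm_sub : forall i, i < r -> B i \subset A;
  cm_nonempty : forall i, i < r -> B i != finset.set0;
  cm_connected : forall i, i < r -> connected_in e (B i);
  cm_disjoint : forall i j, i < j < r -> [disjoint B i & B j];
  cm_adj : forall i j, i < j < r ->
    exists x y, [/\ x \in B i, y \in B j & e x y] }.

Definition deg_in e A x : nat := \sum_(y in A) e x y.
Definition deg_sum e A : nat := \sum_(x in A) deg_in e A x.

Lemma deg_in_card e A x : deg_in e A x = #|[set y in A | e x y]|.
Proof.
rewrite -sum1_card /deg_in big_mkcond [RHS]big_mkcond; apply: eq_bigr => y _.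
by rewrite inE; case: (y \in A); case: (e x y).
Qed.

Lemma deg_sumD1 e A u : symmetric e -> irreflexive e -> u \in A ->
  deg_sum e A = deg_sum e (A :\ u) + 2 * deg_in e (A :\ u) u.
Proof.
move=> es ei uA; rewrite /deg_sum (big_setD1 u uA) /=.
have -> : deg_in e A u = deg_in e (A :\ u) u.
  by rewrite /deg_in (big_setD1 u uA) /= ei.
rewrite (eq_bigr (fun x => e u x + deg_in e (A :\ u) x)) => [|x _].
  by rewrite big_split /= -/(deg_in e (A :\ u) u); lia.
by rewrite /deg_in (big_setD1 u uA) /= es.
Qed.

(** [v] is merged into [u] but stays in the type; it is discarded by passing to [A :\ v]. *)
Definition contract e (u v : T) : rel T :=
  [rel x y | (x != y) && [|| e x y, (x == u) && e v y | (y == u) && e v x]].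

Lemma contract_sym e u v : symmetric e -> symmetric (contract e u v).
Proof.
move=> es x y; rewrite /contract /= eq_sym es; congr (_ && (_ || _)).
by rewrite orbC.
Qed.

Lemma contract_irrefl e u v : irreflexive (contract e u v).
Proof. by move=> x; rewrite /contract /= eqxx. Qed.

(** Contraction loses the edge uv and, for each common neighbour of its ends, one of two edges that
    become parallel. *)
Lemma deg_sum_contract e A u v : symmetric e -> irreflexive e ->
  u \in A -> v \in A -> e u v ->
  deg_sum e A = deg_sum (contract e u v) (A :\ v) +
    2 * (#|[set y in A | e u y && e v y]|).+1.
Proof.
move=> es ei uA vA uv.
have uv' : u != v by apply: contraTneq uv => ->; rewrite ei.
have uAv : u \in A :\ v by rewrite !inE uv'.
rewrite (deg_sumD1 es ei vA) (deg_sumD1 es ei uAv).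
rewrite (deg_sumD1 (contract_sym u v es) (contract_irrefl e u v) uAv).
set A2 := (A :\ v) :\ u.
have -> : deg_sum (contract e u v) A2 = deg_sum e A2.
  apply: eq_bigr => x xA; rewrite /deg_in; apply: eq_bigr => y yA; move: xA yA.
  rewrite !inE => /and3P[xu xv xA] /and3P[yu yv yA].
  rewrite /contract /= (negbTE xu) (negbTE yu) !orbF.
  by case: eqVneq => // ->; rewrite ei.
have -> : deg_in e (A :\ v) v = 1 + deg_in e A2 v.
  by rewrite /deg_in (big_setD1 u uAv) /= es uv.
have -> : #|[set y in A | e u y && e v y]| = \sum_(y in A2) (e u y && e v y).
  rewrite -sum1_card [LHS]big_mkcond [RHS]big_mkcond; apply: eq_bigr => y _.
  rewrite !inE; case: (eqVneq y u) => [->|_]; first by rewrite ei andbF.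
  case: (eqVneq y v) => [->|_]; first by rewrite ei !andbF.
  by case: (y \in A) (e u y) (e v y) => [] [] [].
have -> : deg_in (contract e u v) A2 u = \sum_(y in A2) (e u y || e v y).
  rewrite /deg_in; apply: eq_bigr => y; rewrite !inE => /and3P[yu _ _].
  by rewrite /contract /= eqxx (eq_sym u) yu (negbTE yu) /= orbF.
have : deg_in e A2 u + deg_in e A2 v =
    \sum_(y in A2) (e u y || e v y) + \sum_(y in A2) (e u y && e v y).
  rewrite -!big_split /=; apply: eq_bigr => y _.
  by case: (e u y) (e v y) => [] [].
by lia.
Qed.

(** Returning [v] to the branch set of [u] undoes the contraction: an edge of the contracted graph
    lifts to an edge or to a path of length two through [v]. *)
Lemma clique_model_contract e A u v r B : symmetric e -> v \in A -> e u v ->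
  u \in A -> clique_model (contract e u v) (A :\ v) r B ->
  clique_model e A r (fun i => if u \in B i then v |: B i else B i).
Proof.
move=> es vA uv uA [sub ne con dis ad].
have vB i : i < r -> v \notin B i.
  by move/sub/fintype.subsetP => h; apply/negP => /h; rewrite !inE eqxx.
have uniqu i j : i < j < r -> u \in B i -> u \in B j -> False.
  by move=> ij ui uj; move: (dis _ _ ij) => /pred0P/(_ u) /=; rewrite ui uj.
have subD i : B i \subset (if u \in B i then v |: B i else B i).
  by case: ifP => // _; apply: finset.subsetUr.
split=> [i ir|i ir|i ir|i j ij|i j ij].
- have h : B i \subset A by apply: fintype.subset_trans (sub i ir) (finset.subD1set _ _).
  by case: ifP => // _; rewrite finset.subUset finset.sub1set vA.
- have [x xB] := finset.set0Pn _ (ne i ir); apply/finset.set0Pn; exists x.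
  exact: (fintype.subsetP (subD i)).
- set B' := if _ then _ else _.
  have sB x : x \in B i -> x \in B' by apply/fintype.subsetP/subD.
  have step : subrel (restrict_rel (contract e u v) (B i))
      (connect (restrict_rel e B')).
    move=> x y /= /and3P[xB yB /andP[_ /or3P[xy|/andP[/eqP xu vy]|/andP[/eqP yu vx]]]].
    + by apply: connect1; rewrite /restrict_rel /= !sB.
    + have vB' : v \in B' by rewrite /B' -xu xB !inE eqxx.
      apply: (@connect_trans _ _ v); apply: connect1; rewrite /restrict_rel /= vB' sB //.
      by rewrite xu.
    + have vB' : v \in B' by rewrite /B' -yu yB !inE eqxx.
      apply: (@connect_trans _ _ v); apply: connect1; rewrite /restrict_rel /= vB' sB //.
        by rewrite es.
      by rewrite yu es.
  have cB x y : x \in B i -> y \in B i -> connect (restrict_rel e B') x y.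
    by move=> xB yB; apply: connect_sub step _ _ _; apply: con.
  have memB' x : x \in B' -> (u \in B i /\ x = v) \/ x \in B i.
    by rewrite /B'; case: ifP => ui; [case/finset.setU1P => [->|]; [left|right]|right].
  have cu x y : x \in B' -> y \in B i -> connect (restrict_rel e B') x y.
    case/memB' => [[ui ->] yB|]; last exact: cB.
    apply: connect_trans (cB u y ui yB); apply: connect1.
    by rewrite /restrict_rel /= (sB u ui) es uv /B' ui !inE eqxx.
  have csym : connect_sym (restrict_rel e B').
    by apply: sym_connect_sym => x y; rewrite /restrict_rel /= es andbCA.
  have [w wB] := finset.set0Pn _ (ne i ir).
  move=> x y xB yB; apply: (@connect_trans _ _ w); first exact: cu.
  by rewrite csym; apply: cu.
- have [ir jr] : i < r /\ j < r by lia.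
  rewrite -finset.setI_eq0; apply/eqP/finset.setP => x; rewrite !inE.
  have := pred0P (dis i j ij) x; rewrite /=.
  case: ifP => ui; case: ifP => uj; rewrite ?inE //.
  + by case: (uniqu i j ij ui uj).
  + by case: eqVneq => [->|] //; rewrite (negbTE (vB j jr)).
  + by case: eqVneq => [->|] //; rewrite (negbTE (vB i ir)).
- have [x [y [xB yB /andP[_ /or3P[xy|/andP[/eqP xu vy]|/andP[/eqP yu vx]]]]]] := ad i j ij.
  + by exists x, y; split=> //; apply: (fintype.subsetP (subD _)).
  + exists v, y; split=> //; first by rewrite -xu xB !inE eqxx.
    exact: (fintype.subsetP (subD _)).
  + exists x, v; split=> //; [exact: (fintype.subsetP (subD _))|rewrite -yu yB !inE eqxx //|].
    by rewrite es.
Qed.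

Lemma clique_modelS e A N v r B : N \subset A -> v \in A ->
  {in N, forall y, e v y && (v != y)} -> clique_model e N r B ->
  clique_model e A r.+1 (fun i => if i is i'.+1 then B i' else [set v]).
Proof.
move=> NA vA vN [sub ne con dis ad].
have sub' i x : i < r -> x \in B i -> x \in N by move=> /sub/fintype.subsetP; apply.
split=> [[|i] ir|[|i] ir|[|i] ir|[|i] [|j] // ij|[|i] [|j] // ij].
- by rewrite finset.sub1set.
- exact: fintype.subset_trans (sub i ir) NA.
- by apply/finset.set0Pn; exists v; rewrite inE.
- exact: ne.
- by move=> x y /finset.set1P-> /finset.set1P->; apply: connect0.
- exact: con.
- rewrite disjoints1; apply/negP => vB; have jr : j < r by lia.
  by have /andP[_] := vN v (sub' j v jr vB); rewrite eqxx.
- exact: dis.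
- have [|y yB] := finset.set0Pn _ (ne j _); first by lia.
  by exists v, y; rewrite inE eqxx; split=> //; have /andP[] := vN y (sub' j y ltac:(lia) yB).
- by apply: ad.
Qed.

(* An edge with fewer than [2 ^ r] common neighbours can be contracted without *)
(* losing density; if there is none, neighbourhoods are dense.                *)
Theorem dense_clique_model (r : nat) e A : symmetric e -> irreflexive e ->
  A != finset.set0 -> 2 ^ r * #|A| <= deg_sum e A -> exists B, clique_model e A r.+2 B.
Proof.
elim: r e A => [|r IHr] e A es ei.
  move=> A0; rewrite mul1n => dA.
  have : 0 < deg_sum e A by apply: leq_trans dA; rewrite card_gt0.
  rewrite lt0n sum_nat_eq0 negb_forall => /existsP[x]; rewrite negb_imply.
  case/andP => xA; rewrite sum_nat_eq0 negb_forall => /existsP[y].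
  rewrite negb_imply eqb0 negbK => /andP[yA xy].
  have xney : x != y by apply: contraTneq xy => ->; rewrite ei.
  have yN : {in [set y], forall z, e x z && (x != z)}.
    by move=> z /finset.set1P->; rewrite xy.
  exists (fun i => if i is i'.+1 then [set y] else [set x]).
  apply: (clique_modelS (N := [set y]) _ xA yN (B := fun=> [set y])).
    by rewrite finset.sub1set.
  split=> [i _|i _|i _|i j|i j]; try by lia.
  - exact: subxx.
  - by apply/finset.set0Pn; exists y; rewrite inE.
  - by move=> u v /finset.set1P-> /finset.set1P->; apply: connect0.
move: {2}#|A| (leqnn #|A|) => n; elim: n e A es ei => [|n IHn] e A es ei.
  by rewrite leqn0 cards_eq0 => ->.
move=> An A0 dA.
have [/existsP[u /existsP[v /and4P[uA vA uv few]]]|/existsPn many] :=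
  boolP [exists u, exists v, [&& u \in A, v \in A, e u v
    & #|[set y in A | e u y && e v y]| < 2 ^ r]].
  have cA : #|A| = #|A :\ v|.+1 by rewrite (finset.cardsD1 v) vA.
  have [|||||B hB] := IHn (contract e u v) (A :\ v).
  - exact: contract_sym.
  - exact: contract_irrefl.
  - by lia.
  - apply/finset.set0Pn; exists u; rewrite !inE uA andbT.
    by apply: contraTneq uv => ->; rewrite ei.
  (* With fewer than 2^r common neighbours the loss is at most 2^(r+1), which is what one vertex
     contributes to the bound. *)
  - move: dA; rewrite (deg_sum_contract es ei uA vA uv) cA expnS mulnS.
    by move: few; set c := 2 ^ r; set t := #|[set _ in _ | _]|; set d := deg_sum _ _; nia.
  by eexists; apply: clique_model_contract hB.
have : 0 < deg_sum e A.
  by apply: leq_trans dA; rewrite muln_gt0 expn_gt0 card_gt0.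
rewrite lt0n sum_nat_eq0 negb_forall => /existsP[v]; rewrite negb_imply.
case/andP => vA; rewrite deg_in_card cards_eq0.
set N := [set y in A | e v y] => N0.
(* All edges at [v] have at least 2^r common neighbours, so every vertex of [N] has at least 2^r
   neighbours in [N]; [v] then becomes an additional singleton branch set. *)
have [B hB] : exists B, clique_model e N r.+2 B.
  apply: IHr => //; rewrite /deg_sum mulnC -sum_nat_const; apply: leq_sum => w.
  rewrite inE => /andP[wA vw]; rewrite deg_in_card.
  have := many v; rewrite negb_exists => /forallP/(_ w); rewrite vA wA vw /= -leqNgt.
  move=> h; apply: leq_trans h (fintype.subset_leq_card _); apply/fintype.subsetP => y.
  by rewrite !inE andbA.
eexists; apply: (clique_modelS _ vA) hB.
  by apply/fintype.subsetP => y; rewrite inE => /andP[].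
move=> y; rewrite inE => /andP[_ vy]; rewrite vy /=.
by apply: contraTneq vy => ->; rewrite ei.
Qed.
End CliqueModels.

Import Order.TTheory GRing.Theory Num.Theory.
Import numFieldNormedType.Exports.
Local Open Scope ring_scope.

(** * Orientations and general position in the plane *)

Section GeneralPosition.
Variable R : realFieldType.
Implicit Types p q : R * R.

Definition det3 (a b c : R * R) : R :=
  (b.1 - a.1) * (c.2 - a.2) - (b.2 - a.2) * (c.1 - a.1).

Definition general_position (I : eqType) (P : I -> R * R) : Prop :=
  forall a b c, uniq [:: a; b; c] -> det3 (P a) (P b) (P c) != 0.

Definition orientation (I : eqType) (P : I -> R * R) (a b c : I) : bool :=
  0 < det3 (P a) (P b) (P c).

(** In each of the two vanishing sums of determinants, nonzero terms cannot all have the same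
    sign. *)
Lemma orientation_chirotope (I : eqType) (P : I -> R * R) :
  general_position P -> chirotope (orientation P).
Proof.
have anti a b c : det3 b a c = - det3 a b c by rewrite /det3; ring.
have sgM (x y : R) : x != 0 -> y != 0 ->
    ((0 < x) == (0 < y)) = (0 < x * y).
  case: (ltrgtP x 0) => // hx _; case: (ltrgtP y 0) => // hy _;
  by [rewrite nmulr_rgt0 // hy | rewrite nmulr_rgt0 // ltNge (ltW hy)
     | rewrite pmulr_rgt0 // ltNge (ltW hy) | rewrite pmulr_rgt0 // hy].
move=> gp; split=> [a b c|a b c u|a b c d u|a b c d e u]; rewrite /orientation.
- by congr (0 < _); rewrite /det3; ring.
- rewrite anti oppr_gt0; case: ltrgtP => //; have := gp _ _ _ u.
  by move=> + e0; rewrite e0 eqxx.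
- split_uniq u.
  have {}gp x y w : uniq [:: x; y; w] -> det3 (P x) (P y) (P w) != 0 by apply: gp.
  have h1 := gp b c d ltac:(solve_uniq); have h2 := gp a c d ltac:(solve_uniq).
  have h3 := gp a b d ltac:(solve_uniq); have h4 := gp a b c ltac:(solve_uniq).
  have : det3 (P b) (P c) (P d) - det3 (P a) (P c) (P d) + det3 (P a) (P b) (P d)
    - det3 (P a) (P b) (P c) = 0 by rewrite /det3; ring.
  move: h1 h2 h3 h4.
  case: (ltrgtP 0 (det3 (P b) (P c) (P d))) => // ? _;
  case: (ltrgtP 0 (det3 (P a) (P c) (P d))) => // ? _;
  case: (ltrgtP 0 (det3 (P a) (P b) (P d))) => // ? _;
  case: (ltrgtP 0 (det3 (P a) (P b) (P c))) => // ? _ ?; exfalso; lra.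
- split_uniq u.
  have {}gp x y w : uniq [:: x; y; w] -> det3 (P x) (P y) (P w) != 0 by apply: gp.
  have h1 := gp a b c ltac:(solve_uniq); have h2 := gp a d e ltac:(solve_uniq).
  have h3 := gp a b d ltac:(solve_uniq); have h4 := gp a c e ltac:(solve_uniq).
  have h5 := gp a b e ltac:(solve_uniq); have h6 := gp a c d ltac:(solve_uniq).
  have : det3 (P a) (P b) (P c) * det3 (P a) (P d) (P e) -
    det3 (P a) (P b) (P d) * det3 (P a) (P c) (P e) +
    det3 (P a) (P b) (P e) * det3 (P a) (P c) (P d) = 0 by rewrite /det3; ring.
  rewrite !sgM //.
  have := mulf_neq0 h1 h2; have := mulf_neq0 h3 h4; have := mulf_neq0 h5 h6.
  move: (_ * _) => x; move: (_ * _) => y; move: (_ * _) => w.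
  case: (ltrgtP 0 x) => // ? _; case: (ltrgtP 0 y) => // ? _;
  case: (ltrgtP 0 w) => // ? _ ?; exfalso; lra.
Qed.

Lemma cross_meet (I : eqType) (P : I -> R * R) (a b c d : I) :
  general_position P -> uniq [:: a; b; c; d] -> cross (orientation P) a b c d ->
  exists s t : R, [/\ 0 <= s <= 1, 0 <= t <= 1,
    s * (P a).1 + (1 - s) * (P b).1 = t * (P c).1 + (1 - t) * (P d).1 &
    s * (P a).2 + (1 - s) * (P b).2 = t * (P c).2 + (1 - t) * (P d).2].
Proof.
move=> gp u; split_uniq u.
have {}gp x y w : uniq [:: x; y; w] -> det3 (P x) (P y) (P w) != 0 by apply: gp.
have h1 := gp a b c ltac:(solve_uniq); have h2 := gp a b d ltac:(solve_uniq).
have h3 := gp c d a ltac:(solve_uniq); have h4 := gp c d b ltac:(solve_uniq).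
rewrite /cross /orientation => /andP[ne1 ne2].
pose A := det3 (P a) (P b) (P c); pose B := det3 (P a) (P b) (P d).
pose C := det3 (P c) (P d) (P a); pose D := det3 (P c) (P d) (P b).
have frac (x y : R) : x != 0 -> y != 0 -> (0 < x) != (0 < y) ->
   x - y != 0 /\ 0 <= - y / (x - y) <= 1.
  case: (ltrgtP 0 x) => // hx _; case: (ltrgtP 0 y) => // hy _ _.
    have xy : 0 < x - y by lra.
    by split; [lra | rewrite divr_ge0 ?ler_pdivrMr //; lra].
  have xy : 0 < y - x by lra.
  have -> : - y / (x - y) = y / (y - x) by field; lra.
  by split; [lra | rewrite divr_ge0 ?ler_pdivrMr //; lra].
have [n1 f1] := frac _ _ h1 h2 ne1; have [n2 f2] := frac _ _ h3 h4 ne2.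
(* The orientation against the line cd is affine along ab, with values C and D at the ends; the
   weights make it vanish. Likewise for A and B along cd. *)
exists (- D / (C - D)), (- B / (A - B)); split=> //.
  by rewrite /A /B /C /D; move: n1 n2; rewrite /det3 => n1 n2; field; rewrite n1 n2.
by rewrite /A /B /C /D; move: n1 n2; rewrite /det3 => n1 n2; field; rewrite n1 n2.
Qed.

Lemma small_non_root (p : {poly R}) (d : R) : p != 0 -> 0 < d ->
  exists2 t, 0 < t < d & ~~ root p t.
Proof.
(* There are [size p] candidates, more than [p] can have roots; [k.+2] keeps them strictly below
   [d]. *)
move=> p0 d0; pose s := [seq d / k.+2%:R | k <- iota 0 (size p)].
have us : uniq s.
  rewrite map_inj_in_uniq ?iota_uniq // => i j _ _ /(mulfI (lt0r_neq0 d0)).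
  by move/invr_inj/eqP; rewrite eqr_nat => /eqP [].
case: (altP (allP (a := root p) (s := s))) => [/allP h|].
  by have := max_poly_roots p0 h us; rewrite size_map size_iota ltnn.
rewrite -has_predC => /hasP[_ /mapP[k _ ->] nr]; exists (d / k.+2%:R) => //.
rewrite divr_gt0 ?ltr0n //= ltr_pdivrMr ?ltr0n // ltr_pMr // ltr1n //.
Qed.

Lemma perturb_general_position (I : finType) (P : I -> R * R) (eps : R) :
  0 < eps -> exists2 P' : I -> R * R, general_position P' &
  forall i, `|(P' i).1 - (P i).1| < eps /\ `|(P' i).2 - (P i).2| < eps.
Proof.
move=> eps0; pose r (i : I) : R := (enum_rank i)%:R.
(* Moving the points along the parabola [(r, r^2)]: the orientation of a       *)
(* triple is a polynomial in [t] whose leading coefficient is Vandermonde.    *)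
pose P' t i := ((P i).1 + t * r i, (P i).2 + t * r i ^+ 2).
pose D2 a b c := (r b - r a) * (r c - r a) * (r c - r b).
pose D1 a b c := (r b - r a) * ((P c).2 - (P a).2)
  + ((P b).1 - (P a).1) * (r c ^+ 2 - r a ^+ 2)
  - (r b ^+ 2 - r a ^+ 2) * ((P c).1 - (P a).1)
  - ((P b).2 - (P a).2) * (r c - r a).
pose q a b c : {poly R} :=
  (det3 (P a) (P b) (P c))%:P + D1 a b c *: 'X + D2 a b c *: 'X^2.
have qE t a b c : (q a b c).[t] = det3 (P' t a) (P' t b) (P' t c).
  by rewrite /q !hornerE /det3 /D1 /D2 /P' /=; ring.
have r_inj : injective r.
  by move=> i j /eqP; rewrite eqr_nat => /eqP /val_inj /enum_rank_inj.
have q0 a b c : uniq [:: a; b; c] -> q a b c != 0.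
  move=> u; apply/eqP => /(congr1 (fun p : {poly R} => p`_2)).
  rewrite /q !coefD coefC !coefZ coefX coefXn /= mulr0 !add0r mulr1 coef0.
  split_uniq u; rewrite /D2 => /eqP; rewrite !mulf_eq0 !subr_eq0 !(inj_eq r_inj).
  by case/orP=> [/orP[]|]; rewrite eq_sym; apply/negP.
(* One [t] that is not a root of the product serves all triples at once. *)
pose p := \prod_(x : I * I * I | uniq [:: x.1.1; x.1.2; x.2]) q x.1.1 x.1.2 x.2.
have p0 : p != 0 by apply/prodf_neq0 => x; apply: q0.
pose N : R := #|I|%:R.
have N0 : 0 <= N by rewrite ler0n.
have d0 : 0 < eps / (N ^+ 2 + N + 1) by rewrite divr_gt0 //; nra.
have [t /andP[t0 td] nr] := small_non_root p0 d0.
exists (P' t) => [a b c u|i].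
  rewrite -qE; apply: contra nr => /eqP qa; rewrite /root /p horner_prod.
  by rewrite (bigD1 (a, b, c)) //= qa mul0r.
have ri0 : 0 <= r i by rewrite ler0n.
have riN : r i <= N by rewrite ler_nat ltnW.
move: td; rewrite ltr_pdivlMr; last by nra.
move=> td; rewrite /P' /= ![_ + _ - _]addrC !addKr !normrM !ger0_norm ?(ltW t0) ?exprn_ge0 //.
by split; apply: le_lt_trans td; rewrite ler_wpM2l ?(ltW t0) //; nra.
Qed.
End GeneralPosition.

(** * Fine polygonal chains must come close *)

Section Chains.

Lemma addb_big_true (T : eqType) (s : seq T) (P F : pred T) :
  \big[addb/false]_(i <- s | P i) F i -> exists2 i, i \in s & P i && F i.
Proof.
move=> h; apply/hasP; apply: contraLR h => /hasPn h.
by rewrite big_seq_cond big1 // => i /andP[/h + Pi]; rewrite Pi => /negbTE.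
Qed.

Lemma segments_map (T U : Type) (f : T -> U) x s :
  segments (f x) (map f s) = [seq (f p.1, f p.2) | p <- segments x s].
Proof. by rewrite /segments; elim: s x => //= y s IH x; rewrite IH. Qed.

Lemma segments_subseq (T : eqType) (x : T) s p :
  p \in segments x s -> subseq [:: p.1; p.2] (x :: s).
Proof.
elim: s x => [//|y s IH] x; rewrite inE => /orP[/eqP->|/IH h].
  by rewrite /= !eqxx sub0seq.
exact: subseq_trans h (subseq_cons _ _).
Qed.

Variables (R : realFieldType) (E : seq (nat * nat)) (k : nat).
Hypothesis hE : crossing_odd E k.
Variables (pt : nat -> R * R) (M : nat * nat -> seq (R * R)) (eps : R).
Hypothesis eps0 : 0 < eps.

Let tail e := rcons (M e) (pt e.2).

Definition box_close (c d : R * R) (a : R) : Prop :=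
  `|c.1 - d.1| < a /\ `|c.2 - d.2| < a.

(** After a perturbation by less than eps / 2 the odd crossing parity forces an actual crossing of
    two independent chains. *)
Theorem chains_meet :
  (forall e p, e \in E -> p \in segments (pt e.1) (tail e) -> box_close p.1 p.2 eps) ->
  exists e f p q, [/\ e \in E, f \in E, indep e f,
    p \in segments (pt e.1) (tail e) &
    q \in segments (pt f.1) (tail f) /\ box_close p.1 q.1 (4 * eps)].
Proof.
move=> short.
pose m := (\max_(e <- E) size (M e))%N.
(* Labels instead of points, since sample points may coincide before the perturbation: vertices,
   sample points by edge and position, and [None] for the apex. *)
pose I := option ('I_k.+1 + 'I_(size E).+1 * 'I_m.+1)%type.
pose r v : I := Some (inl (inord v)).
pose T e j : I := Some (inr (inord (index e E), inord j)).
pose P (i : I) : R * R := match i with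
  | None => 0
  | Some (inl v) => pt v
  | Some (inr (e, j)) => (M (nth (0, 0)%N E e))`_j end.
pose S e := rcons [seq T e j | j <- iota 0 (size (M e))] (r e.2).
have eps2 : 0 < eps / 2 by rewrite divr_gt0.
have [P' gp P'P] := perturb_general_position P eps2.
have ho := orientation_chirotope gp.
have Mm e : e \in E -> (size (M e) <= m)%N.
  by move=> eE; rewrite /m (big_rem e) //= leq_maxl.
have r_inj u v : (u <= k)%N -> (v <= k)%N -> r u = r v -> u = v.
  by move=> uk vk [/(congr1 val)]; rewrite /= !inordK.
have Pr v : (v < k)%N -> P (r v) = pt v by move=> vk; rewrite /P /= inordK // ltnW.
have vE e : e \in E -> [/\ e.1 != e.2, (e.1 < k)%N & (e.2 < k)%N].
  by move/(co_vertex hE)/and3P.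
have PS e : e \in E -> map P (S e) = tail e.
  move=> eE; have [_ _ k2] := vE e eE.
  rewrite /S /tail map_rcons Pr // -map_comp; congr rcons.
  apply: (@eq_from_nth _ 0) => [|j]; rewrite size_map size_iota // => jM.
  rewrite (nth_map 0%N) ?size_iota //= nth_iota // add0n.
  rewrite inordK ?nth_index // ?inordK // ltnS ?index_size //.
  by rewrite (leq_trans (ltnW jM)) ?Mm.
have memT e i : i \in [seq T e j | j <- iota 0 (size (M e))] ->
    exists j, i = T e j by case/mapP=> j _ ->; exists j.
have uT e : e \in E -> uniq [seq T e j | j <- iota 0 (size (M e))].
  move=> eE; rewrite map_inj_in_uniq ?iota_uniq // => i j.
  rewrite !mem_iota /= !add0n => iM jM [/(congr1 val)] /=.
  by rewrite !inordK // ltnS (leq_trans (ltnW _) (Mm e eE)).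
have rT v e : r v \notin [seq T e j | j <- iota 0 (size (M e))].
  by apply/negP => /memT[].
have uS e : e \in E -> uniq (r e.1 :: S e).
  move=> eE; have [n12 k1 k2] := vE e eE.
  rewrite /= /S rcons_uniq mem_rcons inE negb_or !rT uT // !andbT.
  by apply: contra n12 => /eqP/r_inj -> //; apply: ltnW.
have memS e i : i \in r e.1 :: S e ->
    [\/ i = r e.1, i = r e.2 | exists j, i = T e j].
  rewrite /S inE mem_rcons inE => /or3P[/eqP|/eqP|/memT];
    by [constructor 1|constructor 2|constructor 3].
have uniq_S e f : e \in E -> f \in E -> indep e f ->
    uniq ((r e.1 :: S e) ++ [:: None, r f.1 & S f]).
  move=> eE fE /and4P[n11 n12 n21 n22].
  have [_ /ltnW k1 /ltnW k2] := vE e eE; have [_ /ltnW l1 /ltnW l2] := vE f fE.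
  have ef : e != f by apply: contra n11 => /eqP->.
  have Nf : None \notin r f.1 :: S f by apply/negP => /memS[|//|[]].
  have Ne : None \notin r e.1 :: S e by apply/negP => /memS[|//|[]].
  rewrite cat_uniq uS // [uniq (None :: _)]cons_uniq Nf uS // andTb !andbT.
  apply/hasPn => i; rewrite inE => /orP[/eqP->//|/memS hf].
  apply/negP => /memS he.
  have inT : T f = T e -> False.
    move=> /(congr1 (@^~ 0%N)) [] /(congr1 val) /=.
    rewrite !inordK ?ltnS ?index_size // => /(congr1 (nth e E)).
    by rewrite !nth_index // => fe; rewrite fe eqxx in ef.
  case: hf he => [->|->|[j ->]] [||[j']] //.
  - by move/r_inj => h; move: n11; rewrite h ?eqxx.
  - by move/r_inj => h; move: n21; rewrite h ?eqxx.
  - by move/r_inj => h; move: n12; rewrite h ?eqxx.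
  - by move/r_inj => h; move: n22; rewrite h ?eqxx.
  by case=> ? _; apply: inT; rewrite /T; congr (fun i j => Some (inr (i, inord j))).
have last_S e : e \in E -> last (r e.1) (S e) = r e.2 by rewrite /S last_rcons.
have r_neq e : e \in E -> r e.1 != r e.2.
  by move/uS; rewrite /S /= mem_rcons inE negb_or => /andP[/andP[]].
have := co_straight hE (I := I) (r := r) ho.
rewrite -(independent_crossings_straight ho (z := None) (S := S)) //;
  last exact: co_closed hE.
rewrite map_inj_in_uniq ?iota_uniq => [/(_ isT)|i j]; last first.
  by rewrite !mem_iota /= !add0n => ik jk; apply: r_inj; apply: ltnW.
move=> /addb_big_true[e eE] /addb_big_true[f fE] /andP[/andP[ef _]].
rewrite /crossings => /addb_big_true[p pE] /addb_big_true[q qF] /= x.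
exists e, f, (P p.1, P p.2), (P q.1, P q.2).
have seg g y : g \in E -> y \in segments (r g.1) (S g) ->
    (P y.1, P y.2) \in segments (pt g.1) (tail g).
  move=> gE yg; have [_ k1 _] := vE g gE.
  rewrite -PS // -Pr // segments_map; apply/mapP; by exists y.
split; [by []|by []|by []|exact: seg|split; first exact: seg].
have [s1 s2] := short _ _ eE (seg _ _ eE pE).
have [t1 t2] := short _ _ fE (seg _ _ fE qF).
have u4 : uniq [:: p.1; p.2; q.1; q.2].
  apply: subseq_uniq (uniq_S e f eE fE ef).
  apply: (@cat_subseq _ [:: p.1; p.2] [:: q.1; q.2]); first exact: segments_subseq.
  exact: subseq_trans (segments_subseq qF) (subseq_cons _ _).
have [a [b [a01 b01 h1 h2]]] := cross_meet gp u4 x.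
have [] := P'P p.1; have [] := P'P p.2; have [] := P'P q.1; have [] := P'P q.2.
move: s1 s2 t1 t2 h1 h2; rewrite /box_close /=.
move: (P' p.1) (P' p.2) (P' q.1) (P' q.2) (P p.1) (P p.2) (P q.1) (P q.2).
move=> [x1 y1] [x2 y2] [x3 y3] [x4 y4] [u1 v1] [u2 v2] [u3 v3] [u4' v4] /=.
(* The common point lies within 3/2 eps of the start of either unperturbed segment, so the starts
   differ by less than 3 eps in each coordinate. *)
have key (z1 z2 z3 z4 w1 w2 w3 w4 : R) : `|w1 - w2| < eps -> `|w3 - w4| < eps ->
    a * z1 + (1 - a) * z2 = b * z3 + (1 - b) * z4 ->
    `|z4 - w4| < eps / 2 -> `|z3 - w3| < eps / 2 -> `|z2 - w2| < eps / 2 ->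
    `|z1 - w1| < eps / 2 -> `|w1 - w3| < 4 * eps.
  rewrite !ltr_norml => /andP[? ?] /andP[? ?] zz /andP[? ?] /andP[? ?] /andP[? ?] /andP[? ?].
  have A1 : a * z1 + (1 - a) * z2 < w1 + 3/2 * eps by nra.
  have A2 : a * z1 + (1 - a) * z2 > w1 - 3/2 * eps by nra.
  have A3 : b * z3 + (1 - b) * z4 < w3 + 3/2 * eps by nra.
  have A4 : b * z3 + (1 - b) * z4 > w3 - 3/2 * eps by nra.
  by apply/andP; split; lra.
by move=> ? ? ? ? ? ? ? ? ? ? ? ? ? ?; split; [apply: (key x1 x2 x3 x4 _ u2 _ u4')
  | apply: (key y1 y2 y3 y4 _ v2 _ v4)].
Qed.
End Chains.

Local Open Scope classical_set_scope.

(** * Plane drawings *)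

Section Drawings.
Variable R : realType.

Definition chain_in (A : set (R * R)) (eps : R) (a b : R * R) : Prop :=
  exists M : seq (R * R), forall s, s \in segments a (rcons M b) ->
    [/\ A s.1, A s.2 & box_close s.1 s.2 eps].

Lemma segments_rcons (T : Type) (a : T) s b :
  segments a (rcons s b) = rcons (segments a s) (last a s, b).
Proof. by rewrite /segments; elim: s a => //= y s IH a; rewrite IH. Qed.

(** The points of [A] reachable from [a] by eps-chains form a nonempty, relatively open and closed
    subset. *)
Lemma connected_chain (A : set (R * R)) (eps : R) a b :
  connected A -> 0 < eps -> A a -> A b -> chain_in A eps a b.
Proof.
move=> cA eps0 Aa Ab.
have near_refl c : box_close c c eps by rewrite /box_close !subrr normr0.
have near_sym c d : box_close c d eps -> box_close d c eps.
  by rewrite /box_close !(distrC c.1) !(distrC c.2).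
have ext c d : A d -> box_close c d eps -> chain_in A eps a c -> chain_in A eps a d.
  move=> Ad cd [M hM]; exists (rcons M c) => s.
  rewrite segments_rcons mem_rcons inE last_rcons => /orP[/eqP->|/hM//].
  split=> //=; have := hM (last a M, c).
  by rewrite segments_rcons mem_rcons inE eqxx => /(_ isT)[].
pose B := [set c | A c /\ chain_in A eps a c].
suff e : B = A by have [] : B b by rewrite e.
apply: cA.
- by exists a; split=> //; exists [::] => s; rewrite inE => /eqP->.
- exists (\bigcup_(c in B) ball c eps).
    by apply: bigcup_open => c _; exact: ball_open.
  apply/seteqP; split=> [c [Ac Bc]|c [Ac [d [_ Bd] dc]]]; last first.
    by split=> //; apply: ext Bd.
  by split=> //; exists c; [|exact: ballxx].
- exists (~` \bigcup_(c in A `\` B) ball c eps).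
    by apply: open_closedC; apply: bigcup_open => c _; exact: ball_open.
  apply/seteqP; split=> [c [Ac Bc]|c [Ac hc]].
    split=> // -[d [Ad nBd] dc]; apply: nBd; split=> //.
    by apply: ext Bc => //; apply: near_sym.
  apply: contrapT => nBc; apply: hc; exists c; last exact: ballxx.
  by split.
Qed.

Lemma jordan_arc_compact (a b : R * R) A : jordan_arc a b A -> compact A.
Proof.
by case=> g [cg _ _ _ ->]; apply: continuous_compact => //; exact: segment_compact.
Qed.

Lemma jordan_arc_connected (a b : R * R) A : jordan_arc a b A -> connected A.
Proof.
case=> g [cg _ _ _ ->]; apply: connected_continuous_connected => //.
exact: segment_connected.
Qed.

Lemma jordan_arc_ends (a b : R * R) A : jordan_arc a b A -> A a /\ A b.
Proof.
case=> g [_ _ <- <- ->]; split; [exists 0|exists 1] => //=;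
  by rewrite in_itv /= ?lexx ?ler01.
Qed.

(** The set of differences a - b is compact, hence closed, and misses 0. *)
Lemma compact_separation (A B : set (R * R)) : compact A -> compact B ->
  A `&` B = set0 ->
  exists2 eps, 0 < eps & forall a b, A a -> B b -> ~ box_close a b eps.
Proof.
move=> cA cB AB.
pose D : set (R * R) := (fun x : (R * R) * (R * R) => x.1 - x.2) @` (A `*` B).
have cD : closed D.
  apply: compact_closed; first exact: norm_hausdorff.
  apply: continuous_compact; last exact: compact_setX.
  apply: continuous_subspaceT => x; apply: cvgB; [exact: cvg_fst|exact: cvg_snd].
have : nbhs (0 : R * R) (~` D).
  apply: open_nbhs_nbhs; split; first exact: closed_openC.
  move=> [[a b] /= [Aa Bb] /subr0_eq ab]; have : (A `&` B) a by split; rewrite // ab.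
  by rewrite AB.
rewrite -nbhs_ballE => -[eps /= eps0 sub]; exists eps => // a b Aa Bb [h1 h2].
apply: (sub (a - b)); last by exists (a, b).
by split; rewrite /= /ball /= sub0r normrN.
Qed.

Lemma uniform_eps (T : finType) (P : T -> R -> Prop) :
  (forall t e e', e <= e' -> P t e' -> P t e) ->
  (forall t, exists2 e, 0 < e & P t e) ->
  exists2 e, 0 < e & forall t, P t e.
Proof.
move=> mono ex.
suff [e e0 h] : exists2 e : R, 0 < e & {in enum T, forall t, P t e}.
  by exists e => // t; apply: h; rewrite mem_enum.
elim: (enum T) => [|t s [e e0 h]]; first by exists 1.
have [e' e'0 Pt] := ex t; exists (Num.min e e'); first by rewrite lt_min e0.
move=> u; rewrite inE => /orP[/eqP->|us]; first by apply: mono Pt; rewrite ge_min lexx orbT.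
by apply: mono (h u us); rewrite ge_min lexx.
Qed.

Variables (G : sgraph) (p : G -> R * R) (E : G -> G -> set (R * R)).
Hypothesis drawn : plane_drawing p E.

(** A common point of two arcs would be a common vertex of their edges, so arcs of independent edges
    are disjoint compact sets; there are finitely many pairs. *)
Lemma drawing_separation : exists2 eps, 0 < eps & forall x y u v,
  adj x y -> adj u v -> x != u -> x != v -> y != u -> y != v ->
  forall a b, E x y a -> E u v b -> ~ box_close a b eps.
Proof.
pose P (t : (G * G) * (G * G)) eps := adj t.1.1 t.1.2 -> adj t.2.1 t.2.2 ->
  t.1.1 != t.2.1 -> t.1.1 != t.2.2 -> t.1.2 != t.2.1 -> t.1.2 != t.2.2 ->
  forall a b, E t.1.1 t.1.2 a -> E t.2.1 t.2.2 b -> ~ box_close a b eps.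
have [t e e' ee' h xy uv n1 n2 n3 n4 a b Ea Eb [h1 h2]||e e0 h] := @uniform_eps _ P.
- by apply: (h xy uv n1 n2 n3 n4 a b Ea Eb); split; apply: lt_le_trans ee'.
- move=> [[x y] [u v]]; rewrite /P /=.
  case xy: (adj x y); last by exists 1.
  case uv: (adj u v); last by exists 1.
  have [/eqP ->|n1] := boolP (x == u); first by exists 1.
  have [/eqP ->|n2] := boolP (x == v); first by exists 1.
  have [/eqP ->|n3] := boolP (y == u); first by exists 1.
  have [/eqP ->|n4] := boolP (y == v); first by exists 1.
  have [|||e e0 h] := @compact_separation (E x y) (E u v).
  + exact: jordan_arc_compact (drawing_edge_arc drawn xy).
  + exact: jordan_arc_compact (drawing_edge_arc drawn uv).
  + rewrite -subset0 => c [Ex Eu].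
    have xu : ~ (x = u /\ y = v) by move=> [e1 _]; rewrite e1 eqxx in n1.
    have xv : ~ (x = v /\ y = u) by move=> [e1 _]; rewrite e1 eqxx in n2.
    have [z [_ zxy zuv]] := drawing_edge_edge drawn xy uv xu xv Ex Eu.
    by case: zxy n1 n2 n3 n4 => <-; case: zuv => <-; rewrite ?eqxx.
  + by exists e.
by exists e => // x y u v; apply: (h ((x, y), (u, v))).
Qed.

Lemma walk_chain (eps : R) (x : G) (s : seq G) : 0 < eps -> path (@adj G) x s ->
  s != [::] -> exists M : seq (R * R),
  forall q, q \in segments (p x) (rcons M (p (last x s))) ->
  box_close q.1 q.2 eps /\
  exists u v, [/\ u \in x :: s, v \in x :: s, adj u v, E u v q.1 & E u v q.2].
Proof.
move=> eps0; elim: s x => // y s IH x /= /andP[xy ys] _.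
have arc := drawing_edge_arc drawn xy.
have [Ex Ey] := jordan_arc_ends arc.
have [M hM] := connected_chain (jordan_arc_connected arc) eps0 Ex Ey.
have first_edge q : q \in segments (p x) (rcons M (p y)) -> box_close q.1 q.2 eps /\
  exists u v, [/\ u \in [:: x, y & s], v \in [:: x, y & s], adj u v, E u v q.1
                & E u v q.2].
  by move/hM => [q1 q2 q12]; split=> //; exists x, y; rewrite !inE !eqxx orbT.
case: s => [|z s] in IH ys first_edge *; first by exists M.
have [//|//|M' hM'] := IH y; exists (rcons M (p y) ++ M') => q.
have -> w : segments (p x) (rcons (rcons M (p y) ++ M') w) =
    segments (p x) (rcons M (p y)) ++ segments (p y) (rcons M' w).
  elim: (M) (p x) => //= a N IHN b.
  by rewrite /segments /= in IHN *; rewrite IHN.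
rewrite mem_cat => /orP[/first_edge//|/hM'[nq [u [v [us vs]]]]].
by split=> //; exists u, v; rewrite inE us orbT inE vs orbT.
Qed.

(** Edges of [K] are realised by walks in the graph, so that both subgraphs and minors are covered.
    Chains with step eps / 4 along the arcs of the walks would come within eps, against the
    separation. *)
Theorem drawing_no_odd_model (K : seq (nat * nat)) (k : nat) (v : nat -> G)
    (W : nat * nat -> seq G) : crossing_odd K k ->
  (forall e : nat * nat, e \in K -> [/\ path (@adj G) (v e.1) (W e), last (v e.1) (W e) = v e.2
                          & v e.1 != v e.2]) ->
  (forall e f : nat * nat, e \in K -> f \in K -> indep e f ->
     forall x, x \in v e.1 :: W e -> x \notin v f.1 :: W f) -> False.
Proof.
move=> oddK walks disj.
have [eps eps0 sep] := drawing_separation.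
have eps4 : 0 < eps / 4 by rewrite divr_gt0.
have /choice[M hM] : forall e : nat * nat, exists M : seq (R * R), e \in K ->
  forall q, q \in segments (p (v e.1)) (rcons M (p (v e.2))) ->
  box_close q.1 q.2 (eps / 4) /\ exists x y,
  [/\ x \in v e.1 :: W e, y \in v e.1 :: W e, adj x y, E x y q.1 & E x y q.2].
  move=> e; case eK: (e \in K); last by exists [::].
  have [pe <- ne] := walks e eK.
  have [|M hM] := walk_chain eps4 pe; last by exists M.
  by apply: contra ne => /eqP We; have [_ <- _] := walks e eK; rewrite We.
have [e q eK qs|e [f [q [q' [eK fK ef qs [q's]]]]]] :=
    chains_meet oddK (pt := p \o v) (M := M) eps4.
  by have [] := hM e eK q qs.
have -> : 4 * (eps / 4) = eps by field.
have [_ [x [y [xe ye xy Exy _]]]] := hM e eK q qs.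
have [_ [x' [y' [xf yf xy' Exy' _]]]] := hM f fK q' q's.
have dis a b : a \in v e.1 :: W e -> b \in v f.1 :: W f -> a != b.
  by move=> ae bf; apply: contraL bf => /eqP<-; apply: disj ae.
by apply: (sep x y x' y' xy xy') => //; apply: dis.
Qed.
End Drawings.

(** * Acyclic graphs of maximum degree two *)

Section LinearForest.
Variables (T : finType) (e : rel T).
Hypotheses (es : symmetric e) (ei : irreflexive e).
Local Open Scope nat_scope.

Lemma clique_model_sub (A N : {set T}) r B : N \subset A ->
  clique_model e N r B -> clique_model e A r B.
Proof.
move=> NA [sub ne con dis ad]; split=> // i ir.
exact: fintype.subset_trans (sub i ir) NA.
Qed.

Lemma deg_in_sub (A N : {set T}) x : N \subset A -> deg_in e N x <= deg_in e A x.
Proof.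
move=> NA; rewrite !deg_in_card; apply: subset_leq_card; apply/fintype.subsetP => y.
by rewrite !inE => /andP[/(fintype.subsetP NA)-> ->].
Qed.

(** If all degrees were at least 2, [dense_clique_model] with r = 1 would give a triangle minor. *)
Lemma low_degree_vertex (A : {set T}) : A != finset.set0 ->
  (forall B, ~ clique_model e A 3 B) -> exists2 x, x \in A & deg_in e A x <= 1.
Proof.
move=> A0 noK3; have [/exists_inP//|] := boolP [exists x in A, deg_in e A x <= 1].
rewrite negb_exists_in => /forall_inP high.
have [|B /noK3//] := @dense_clique_model _ 1 e A es ei A0.
rewrite mulnC -sum_nat_const; apply: leq_sum => x xA.
by rewrite expn1 ltnNge high.
Qed.

(** Strip off [x] and continue from its only neighbour, whose degree has dropped to at most 1, or,
    if [x] is isolated, from any vertex of low degree in the remainder. *)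
Lemma linear_forest_enum (A : {set T}) x :
  (forall B, ~ clique_model e A 3 B) -> {in A, forall y, deg_in e A y <= 2} ->
  x \in A -> deg_in e A x <= 1 ->
  exists s, [/\ uniq (x :: s), x :: s =i A &
    {in A &, forall y z, e y z ->
      index y (x :: s) = (index z (x :: s)).+1 \/
      index z (x :: s) = (index y (x :: s)).+1}].
Proof.
move: {2}#|A| (leqnn #|A|) => n; elim: n A x => [|n IH] A x An noK3 deg2 xA deg1.
  by move: xA; move: An; rewrite leqn0 cards_eq0 => /eqP->; rewrite inE.
have cA := finset.cardsD1 x A; rewrite xA add1n in cA.
have subA : A :\ x \subset A by apply: finset.subD1set.
have memA y : y \in A -> y = x \/ y \in A :\ x.
  by move=> yA; case: (eqVneq y x) => [|yx]; [left|right; rewrite !inE yx].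
have noK3' B : ~ clique_model e (A :\ x) 3 B.
  by move/(clique_model_sub subA)/noK3.
have deg2' : {in A :\ x, forall y, deg_in e (A :\ x) y <= 2}.
  move=> y; rewrite inE => /andP[_ yA]; apply: leq_trans (deg2 y yA).
  exact: deg_in_sub.
have [Ax0|Ax0] := eqVneq (A :\ x) finset.set0.
  exists [::]; split=> // [y|y z].
    by rewrite inE; apply/eqP/idP => [->//|/memA[//|]]; rewrite Ax0 inE.
  by case/memA => [->|]; rewrite ?Ax0 ?inE // => /memA[->|];
    rewrite ?Ax0 ?inE // ei.
have [y [yA deg_y y_only]] : exists y, [/\ y \in A :\ x, deg_in e (A :\ x) y <= 1
    & {in A, forall z, e x z -> z = y}].
  case: (finset.set_0Vmem [set z in A | e x z]) => [N0|[y]].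
    have [y yA y1] := low_degree_vertex Ax0 noK3'.
    exists y; split=> // z zA xz; have : z \in [set z in A | e x z].
      by rewrite inE zA.
    by rewrite N0 inE.
  rewrite inE => /andP[yA xy].
  have yx : y != x by apply: contraTneq xy => ->; rewrite ei.
  exists y; split; first by rewrite !inE yx.
    have := deg2 y yA; rewrite /deg_in (big_setD1 x xA) /= es xy.
    by rewrite add1n.
  move=> z zA xz; apply/eqP; move: deg1; rewrite deg_in_card => /card_le1_eqP.
  by move=> h; apply/eqP/h; rewrite inE ?zA ?yA.
have [|s [us sA adj_s]] := IH (A :\ x) y _ noK3' deg2' yA deg_y; first by lia.
have xs : x \notin y :: s by rewrite sA !inE eqxx.
exists (y :: s); split.
- by rewrite cons_uniq xs.
- by move=> z; rewrite in_cons sA !inE; case: eqVneq => [->|].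
have idx z : z \in A :\ x -> index z [:: x, y & s] = (index z (y :: s)).+1.
  by rewrite !inE => /andP[zx _]; rewrite /= eq_sym (negbTE zx).
have idxx : index x [:: x, y & s] = 0 by rewrite /= eqxx.
have idxy : index y [:: x, y & s] = 1 by rewrite idx //= eqxx.
move=> z w zA wA zw.
case: (memA z zA) zw => [->|zA'] zw.
  by rewrite (y_only w wA zw) idxx idxy; right.
case: (memA w wA) zw => [->|wA'] zw.
  by rewrite (y_only z zA) ?idxx ?idxy; [left|rewrite es].
rewrite !idx //; case: (adj_s z w zA' wA' zw) => ->; by [left|right].
Qed.
End LinearForest.

(** * Excluded minors and degree bounds of planar graphs *)

Section PlanarGraphs.
Variables (R : realType) (G : sgraph).
Hypothesis planarG : planar R G.
Local Open Scope nat_scope.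

(** Choose a representative in each branch set; the edge ij becomes a walk inside the union of
    branch sets i and j, so independent edges get disjoint walks. *)
Lemma planar_no_K5_model (A : {set G}) B : ~ clique_model (@adj G) A 5 B.
Proof.
case: planarG => p [E drawn] [sub ne con dis ad].
have [x0 _] := finset.set0Pn _ (ne 0 isT).
pose v i := odflt x0 [pick x in B i].
have vB i : i < 5 -> v i \in B i.
  rewrite /v; case: pickP => //= h i5; have [y yB] := finset.set0Pn _ (ne i i5).
  by move: (h y); rewrite yB.
have inK5 (e : nat * nat) : e \in K5_edges -> e.1 < e.2 < 5.
  by move: e; apply/allP.
have walk i x y : i < 5 -> x \in B i -> y \in B i ->
    exists s, [/\ path (@adj G) x s, last x s = y & {subset s <= B i}].
  move=> i5 xB yB; have /connectP[s ps ->] := con i i5 x y xB yB.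
  exists s; split=> //.
    by apply: sub_path ps => a b /and3P[].
  elim: s x {xB yB} ps => //= a s IH x /andP[/and3P[_ aB _] ps] b.
  by rewrite inE => /orP[/eqP->//|]; apply: IH ps b.
have /choice[W hW] : forall e : nat * nat, exists s, e \in K5_edges ->
    [/\ path (@adj G) (v e.1) s, last (v e.1) s = v e.2 &
      {subset v e.1 :: s <= B e.1 :|: B e.2}].
  move=> e; case eK: (e \in K5_edges); last by exists [::].
  have e12 := inK5 e eK; have [e1 e2] : e.1 < 5 /\ e.2 < 5 by lia.
  have [x [y [xB yB xy]]] := ad _ _ e12.
  have [s [ps ls sB]] := walk _ _ _ e1 (vB _ e1) xB.
  have [t [pt lt tB]] := walk _ _ _ e2 yB (vB _ e2).
  exists (s ++ y :: t) => _; split.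
  - by rewrite cat_path ps ls /= xy.
  - by rewrite last_cat /=.
  - move=> z; rewrite inE mem_cat inE => /or4P[/eqP->|/sB|/eqP->|/tB];
      rewrite inE ?vB ?yB ?orbT // => ->; by rewrite ?orbT.
have disB i j x : i < 5 -> j < 5 -> i != j -> x \in B i -> x \notin B j.
  move=> i5 j5; rewrite neq_ltn => /orP[] ij xi; apply/negP => xj.
    by have /pred0P/(_ x) := dis i j ltac:(lia); rewrite /= xi xj.
  by have /pred0P/(_ x) := dis j i ltac:(lia); rewrite /= xi xj.
apply: (drawing_no_odd_model drawn (v := v) (W := W) K5_crossing_odd).
  move=> e eK; have [h1 h2 _] := hW e eK; split=> //.
  have e12 := inK5 e eK; have [e1 e2] : e.1 < 5 /\ e.2 < 5 by lia.
  have := disB e.1 e.2 (v e.1) e1 e2 ltac:(lia) (vB _ e1).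
  by apply: contraNneq => ->; apply: vB.
move=> e f eK fK /and4P[n11 n12 n21 n22] x.
have [_ _ We] := hW e eK; have [_ _ Wf] := hW f fK.
have e12 := inK5 e eK; have f12 := inK5 f fK.
move=> /We xe; apply/negP => /Wf; rewrite inE.
case/finset.setUP: xe => xe.
  by rewrite !(negbTE (disB _ _ x _ _ _ xe)) //; lia.
by rewrite !(negbTE (disB _ _ x _ _ _ xe)) //; lia.
Qed.

Lemma planar_no_K33 (s t : seq G) : size s = 3 -> size t = 3 ->
  uniq s -> uniq t -> {in s & t, forall x y, adj x y} -> False.
Proof.
case: s => [|a1 [|a2 [|a3 [|]]]] // _; case: t => [|b1 [|b2 [|b3 [|]]]] // _ us ut st.
case: planarG => p [E drawn].
pose l := [:: a1; a2; a3; b1; b2; b3].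
have ul : uniq l.
  rewrite -[l]/([:: a1; a2; a3] ++ [:: b1; b2; b3]) cat_uniq us ut andTb andbT.
  apply/hasPn => y yt; apply/negP => ys; have := st y y ys yt.
  by rewrite adj_irrefl.
have inK33 (e : nat * nat) : e \in K33_edges -> (e.1 < 3) && (3 <= e.2 < 6).
  by move: e; apply/allP.
have nl i j : i < 6 -> j < 6 -> (nth a1 l i == nth a1 l j) = (i == j).
  by move=> i6 j6; rewrite nth_uniq.
have lo i : i < 3 -> nth a1 l i \in [:: a1; a2; a3].
  by move=> i3; rewrite (_ : nth a1 l i = nth a1 [:: a1; a2; a3] i) ?mem_nth //;
    case: i i3 => [|[|[|]]].
have hi i : 3 <= i < 6 -> nth a1 l i \in [:: b1; b2; b3].
  move=> i3; rewrite (_ : nth a1 l i = nth a1 [:: b1; b2; b3] (i - 3)) ?mem_nth //;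
    by case: i i3 => [|[|[|[|[|[|]]]]]].
apply: (drawing_no_odd_model drawn (v := nth a1 l) (W := fun e => [:: nth a1 l e.2])
  K33_crossing_odd).
  move=> e /inK33/andP[e1 e2] /=; split=> //.
    by rewrite andbT; apply: st; [apply: lo|apply: hi].
  by rewrite nl; lia.
move=> e f /inK33/andP[e1 e2] /inK33/andP[f1 f2] /and4P[n11 n12 n21 n22] x.
rewrite !inE negb_or.
by case/orP => /eqP->; rewrite !nl ?n11 ?n12 ?n21 ?n22 //; lia.
Qed.

Lemma degree_in_setT (x : G) : degree x = deg_in (@adj G) [set: G]%SET x.
Proof.
by rewrite deg_in_card /degree; apply: eq_card => y; rewrite !inE.
Qed.

(** This is [dense_clique_model] with r = 3: the density 2^3 would force a K_5 minor. *)
Lemma planar_degree_sum : 0 < #|G| -> \sum_(x : G) degree x < 8 * #|G|.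
Proof.
move=> G0; rewrite ltnNge; apply/negP => dense.
have [||||B] := @dense_clique_model G 3 (@adj G) [set: G]%SET.
- exact: adj_sym.
- exact: adj_irrefl.
- by rewrite -card_gt0 cardsT.
- rewrite cardsT; apply: leq_trans dense _; rewrite /deg_sum.
  apply: eq_leq; apply: eq_big => [x|x _]; first by rewrite inE.
  exact: degree_in_setT.
- exact: planar_no_K5_model.
Qed.

(** Three vertices have at most two common neighbours; every other vertex is counted at most
    twice. *)
Lemma planar_three_degrees (a b c : G) : uniq [:: a; b; c] ->
  degree a + degree b + degree c <= 2 * #|G| + 2.
Proof.
move=> u; rewrite !degree_in_setT /deg_in -!big_split /=.
pose C := [set y : G | [&& adj a y, adj b y & adj c y]]%SET.
have C2 : #|C| <= 2.
  rewrite leqNgt; apply/negP => C3.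
  apply: (@planar_no_K33 [:: a; b; c] (take 3 (enum C))) => //.
  - by rewrite size_takel // -cardE.
  - by rewrite take_uniq ?enum_uniq.
  move=> x y xs /mem_take; rewrite mem_enum inE => /and3P[ay by_ cy].
  by move: xs; rewrite !inE => /or3P[]/eqP->.
have -> : #|G| = \sum_(y in [set: G]%SET) 1 by rewrite sum1_card cardsT.
apply: leq_trans (leq_add (leqnn _) C2).
rewrite -sum1_card [X in _ <= _ + X]big_mkcond /= big_distrr /=.
rewrite [X in _ <= _ + X](_ : _ = \sum_(y in [set: G]%SET) (y \in C : nat)); last first.
  by apply: eq_big => [y|y _]; rewrite ?inE //; case: ifP.
rewrite -big_split; apply: leq_sum => y _; rewrite inE.
by case: (adj a y) (adj b y) (adj c y) => [] [] [].
Qed.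
End PlanarGraphs.

(** * The signless Laplacian *)

Section Rayleigh.
Variables (R : realType) (n : nat) (M : 'M[R]_n).

Definition bilin (A : 'M[R]_n) (x y : 'rV[R]_n) : R :=
  \sum_i \sum_j x 0 i * A i j * y 0 j.

Lemma bilinE A x y : bilin A x y = \sum_j (x *m A) 0 j * y 0 j.
Proof.
rewrite /bilin exchange_big; apply: eq_bigr => j _.
by rewrite mxE big_distrl.
Qed.

Lemma bilin1 x y : bilin 1%:M x y = \sum_i x 0 i * y 0 i.
Proof. by rewrite bilinE mulmx1. Qed.

Lemma bilinDl A x y z : bilin A (x + y) z = bilin A x z + bilin A y z.
Proof.
by rewrite !bilinE -big_split; apply: eq_bigr => j _; rewrite mulmxDl mxE mulrDl.
Qed.

Lemma bilinZl A a x z : bilin A (a *: x) z = a * bilin A x z.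
Proof.
by rewrite !bilinE big_distrr; apply: eq_bigr => j _; rewrite -scalemxAl mxE /= mulrA.
Qed.

Lemma bilin0l A z : bilin A 0 z = 0.
Proof. by have := bilinZl A 0 0 z; rewrite scale0r mul0r. Qed.

Lemma bilinC A x y : A^T = A -> bilin A x y = bilin A y x.
Proof.
move=> sA; rewrite /bilin exchange_big; apply: eq_bigr => j _.
apply: eq_bigr => i _; rewrite -{1}sA mxE; ring.
Qed.

Lemma bilin1_ge0 x : 0 <= bilin 1%:M x x.
Proof. by rewrite bilin1; apply: sumr_ge0 => i _; rewrite -expr2 sqr_ge0. Qed.

Lemma bilin1_eq0 x : bilin 1%:M x x = 0 -> x = 0.
Proof.
rewrite bilin1 => /eqP; rewrite psumr_eq0 => [/allP h|i _]; last first.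
  by rewrite -expr2 sqr_ge0.
apply/rowP => i; rewrite mxE; have := h i (mem_index_enum i).
by rewrite /= -expr2 sqrf_eq0 => /eqP.
Qed.

Lemma bilin_continuous A : continuous (fun x => bilin A x x).
Proof.
rewrite /bilin; apply: continuous_big => [|i _]; first exact: add_continuous.
apply: continuous_big => [|j _ x]; first exact: add_continuous.
have ci k : (y : 'rV[R]_n) 0 k @[y --> x] --> x 0 k.
  exact: coord_continuous.
exact: (cvgM (cvgM (ci i) (cvg_cst _)) (ci j)).
Qed.

(** The form of aI - M is positive semidefinite and vanishes at [c], so [c] lies in its kernel. *)
Lemma rayleigh_eq a c : M^T = M ->
  (forall y, bilin M y y <= a * bilin 1%:M y y) ->
  bilin M c c = a * bilin 1%:M c c -> c *m M = a *: c.
Proof.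
move=> sM le_a Mc.
pose N := a%:M - M.
have bN x y : bilin N x y = a * bilin 1%:M x y - bilin M x y.
  rewrite !bilinE big_distrr -sumrB; apply: eq_bigr => j _ /=.
  by rewrite mulmxBr mulmx1 mul_mx_scalar !mxE; ring.
have sN : N^T = N by rewrite /N linearB /= tr_scalar_mx sM.
have N0 y : 0 <= bilin N y y by rewrite bN subr_ge0.
have Nc : bilin N c c = 0 by rewrite bN Mc subrr.
have Ncy y : bilin N c y = 0.
  have expand t : bilin N (c + t *: y) (c + t *: y)
      = 2 * t * bilin N c y + t ^+ 2 * bilin N y y.
    have e u : bilin N u (c + t *: y) = bilin N u c + t * bilin N u y.
      by rewrite bilinC // bilinDl bilinZl (bilinC c) // (bilinC y).
    by rewrite bilinDl bilinZl !e Nc (bilinC y) //; ring.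
  (* The quadratic polynomial in [t] is nonnegative without constant term. Its linear coefficient
     vanishes: test it at the minimiser, or, if it is linear, at minus that form value. *)
  have [b0|b0] := eqVneq (bilin N y y) 0.
    have := N0 (c + (- bilin N c y) *: y); rewrite expand b0.
    by move=> h; apply/eqP; rewrite -sqrf_eq0 eq_le sqr_ge0 andbT expr2; nra.
  have bp : 0 < bilin N y y by rewrite lt0r b0 N0.
  have := N0 (c + (- (bilin N c y / bilin N y y)) *: y); rewrite expand.
  have -> : 2 * - (bilin N c y / bilin N y y) * bilin N c y +
    (- (bilin N c y / bilin N y y)) ^+ 2 * bilin N y y =
    - (bilin N c y ^+ 2 / bilin N y y) by field.
  rewrite oppr_ge0 pmulr_lle0 ?invr_gt0 // => h.
  by apply/eqP; rewrite -sqrf_eq0 eq_le sqr_ge0 h.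
have : c *m N = 0.
  apply: bilin1_eq0; rewrite bilin1.
  by rewrite -[RHS](Ncy (c *m N)) bilinE.
by rewrite /N mulmxBr mul_mx_scalar => /subr0_eq.
Qed.

(** The quadratic form attains its maximum on the compact unit sphere; by homogeneity that maximum
    bounds the Rayleigh quotient everywhere. *)
Theorem rayleigh_max : (0 < n)%N -> M^T = M ->
  exists a (x : 'rV[R]_n), [/\ x != 0, x *m M = a *: x &
    forall y, bilin M y y <= a * bilin 1%:M y y].
Proof.
move=> n0 sM.
pose S := [set x : 'rV[R]_n | bilin 1%:M x x = 1].
have cS : compact S.
  apply: bounded_closed_compact.
    exists 1; split=> // b b1 x Sx; rewrite /Num.norm /= mx_normrE.
    apply/bigmax_leP; split=> [|[i j] _ /=]; first lra.
    rewrite (ord1 i); apply: le_trans (ltW b1).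
    rewrite -(@expr_le1 _ 2) ?normr_ge0 // real_normK ?num_real //.
    rewrite -[leRHS]Sx bilin1 (bigD1 j) //= -expr2 lerDl.
    by apply: sumr_ge0 => k _; rewrite -expr2 sqr_ge0.
  rewrite (_ : S = (fun x => bilin 1%:M x x) @^-1` [set 1]) //.
  by apply: preimage_closed; [move=> x _; apply: bilin_continuous|exact: closed_eq].
have [c Sc maxc] : exists2 c, c \in S & forall t, t \in S -> bilin M t t <= bilin M c c.
  apply: compact_EVT_max => //; last first.
    by apply: continuous_subspaceT; exact: bilin_continuous.
  exists (delta_mx 0 (Ordinal n0)); rewrite /S /= bilin1 (bigD1 (Ordinal n0)) //=.
  rewrite big1 => [|i ni]; rewrite !mxE !eqxx ?(negbTE ni) ?mulr0 //=.
  by rewrite mulr1 addr0.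
move: Sc; rewrite inE => Sc; pose a := bilin M c c.
have le_a y : bilin M y y <= a * bilin 1%:M y y.
  have [y0|y0] := eqVneq (bilin 1%:M y y) 0.
    by rewrite (bilin1_eq0 y0) !bilin0l mulr0.
  have yp : 0 < bilin 1%:M y y by rewrite lt0r y0 bilin1_ge0.
  pose t := (Num.sqrt (bilin 1%:M y y))^-1.
  have t2 : t * t * bilin 1%:M y y = 1.
    by rewrite /t -expr2 exprVn sqr_sqrtr ?bilin1_ge0 // mulVf.
  have sZ A u : A^T = A -> bilin A (u *: y) (u *: y) = u * u * bilin A y y.
    by move=> sA; rewrite bilinZl bilinC // bilinZl mulrA.
  have := maxc (t *: y); rewrite inE /S /= sZ ?trmx1 // => /(_ t2).
  rewrite sZ // -/a => h.
  by have := ler_wpM2r (ltW yp) h; rewrite mulrAC t2 mul1r.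
exists a, c; split=> //.
  by apply: contra_eqN Sc => /eqP->; rewrite bilin0l eq_sym oner_eq0.
by apply: rayleigh_eq => //; rewrite Sc mulr1.
Qed.
End Rayleigh.

Section SignlessLaplacian.
Variable R : realType.

Definition slap (G : sgraph) (x : G -> R) (v : G) : R :=
  (degree v)%:R * x v + \sum_(w | adj v w) x w.

Definition slap_form (G : sgraph) (x : G -> R) : R := \sum_v x v * slap x v.

Lemma slap_formE (G : sgraph) (x : G -> R) :
  slap_form x = \sum_v \sum_(w | adj v w) x v * (x v + x w).
Proof.
apply: eq_bigr => v _; rewrite /slap /degree -sum1_card natr_sum.
rewrite big_distrl -big_split big_distrr /=.
by apply: eq_big => [w|w _]; rewrite ?inE // mul1r.
Qed.

(** As a sum of squares of x v + x w, the form cannot decrease when [x] is replaced by its absolute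
    value. *)
Lemma slap_form_edges (G : sgraph) (x : G -> R) :
  2 * slap_form x = \sum_v \sum_(w | adj v w) (x v + x w) ^+ 2.
Proof.
have e : slap_form x = \sum_v \sum_(w | adj v w) x w * (x v + x w).
  rewrite slap_formE (exchange_big_dep xpredT) //=; apply: eq_bigr => v _.
  by apply: eq_big => [w|w _]; rewrite ?(adj_sym v) // addrC.
rewrite mulr2n mulrDl !mul1r {1}slap_formE e -big_split; apply: eq_bigr => v _ /=.
by rewrite -big_split; apply: eq_bigr => w _; rewrite /=; ring.
Qed.

Section Coordinates.
Variable G : sgraph.

Definition row_of (x : G -> R) : 'rV[R]_#|G| := \row_i x (enum_val i).
Definition fun_of_row (u : 'rV[R]_#|G|) (v : G) : R := u 0 (enum_rank v).

Lemma fun_of_rowK u : row_of (fun_of_row u) = u.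
Proof. by apply/rowP => i; rewrite mxE /fun_of_row enum_valK. Qed.

Lemma row_of_mul x i :
  (row_of x *m signless_laplacian R G) 0 i = slap x (enum_val i).
Proof.
rewrite /signless_laplacian mulmxDr mul_mx_diag !mxE; congr (_ + _).
  by rewrite mulrC.
under eq_bigr do rewrite !mxE mulr_natr.
rewrite [RHS]big_mkcond (reindex (enum_val : 'I_#|G| -> G)) /=; last first.
  by apply: onW_bij; apply: enum_val_bij.
by apply: eq_bigr => w _; rewrite adj_sym; case: adj.
Qed.

Lemma signless_laplacian_sym : (signless_laplacian R G)^T = signless_laplacian R G.
Proof.
rewrite /signless_laplacian linearD /= tr_diag_mx; congr (_ + _).
by apply/matrixP => i j; rewrite !mxE adj_sym.
Qed.

Lemma bilin_row_of x : bilin (signless_laplacian R G) (row_of x) (row_of x) = slap_form x.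
Proof.
rewrite bilinE /slap_form (reindex (enum_val : 'I_#|G| -> G)) /=; last first.
  by apply: onW_bij; apply: enum_val_bij.
by apply: eq_bigr => i _; rewrite row_of_mul mxE mulrC.
Qed.

Lemma bilin1_row_of x : bilin 1%:M (row_of x) (row_of x) = \sum_v x v ^+ 2.
Proof.
rewrite bilin1 (reindex (enum_val : 'I_#|G| -> G)) /=; last first.
  by apply: onW_bij; apply: enum_val_bij.
by apply: eq_bigr => i _; rewrite mxE expr2.
Qed.
End Coordinates.

Lemma q_radius_max (G : sgraph) : (0 < #|G|)%N ->
  (exists2 c : 'rV[R]_#|G|, c != 0 &
     c *m signless_laplacian R G = q_radius R G *: c) /\
  forall y, bilin (signless_laplacian R G) y y <= q_radius R G * bilin 1%:M y y.
Proof.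
move=> G0; have [a [c [c0 ca maxa]]] := rayleigh_max G0 (signless_laplacian_sym G).
suff -> : q_radius R G = a by split=> //; exists c.
have ev : eigenvalue (signless_laplacian R G) a by apply/eigenvalueP; exists c.
have ub b : eigenvalue (signless_laplacian R G) b -> b <= a.
  case/eigenvalueP => v vb v0; have := maxa v.
  have -> : bilin (signless_laplacian R G) v v = b * bilin 1%:M v v.
    by rewrite bilinE vb bilin1 big_distrr; apply: eq_bigr => i _; rewrite mxE /= mulrA.
  rewrite ler_pM2r // lt0r bilin1_ge0 andbT.
  by apply: contra v0 => /eqP/bilin1_eq0/eqP.
apply/eqP; rewrite eq_le /q_radius; apply/andP; split.
  by apply: ge_sup => [|b]; [exists a|exact: ub].
by apply: ub_le_sup => //; exists a => b; exact: ub.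
Qed.

Lemma q_radius_ge_form (G : sgraph) (y : G -> R) : (0 < #|G|)%N ->
  slap_form y <= q_radius R G * \sum_v y v ^+ 2.
Proof.
move=> /q_radius_max[_ /(_ (row_of y))].
by rewrite bilin_row_of bilin1_row_of.
Qed.

Lemma q_radius_attained (G : sgraph) (y : G -> R) : (0 < #|G|)%N ->
  slap_form y = q_radius R G * \sum_v y v ^+ 2 ->
  forall v, slap y v = q_radius R G * y v.
Proof.
move=> /q_radius_max[_ maxq] yq v.
have := @rayleigh_eq _ _ _ _ (row_of y) (signless_laplacian_sym G) maxq.
rewrite bilin_row_of bilin1_row_of => /(_ yq)/rowP/(_ (enum_rank v)).
by rewrite row_of_mul !mxE enum_rankK.
Qed.

(** The absolute value of a top eigenvector still maximises the Rayleigh quotient, hence is an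
    eigenvector too. *)
Lemma perron_vector (G : sgraph) : (0 < #|G|)%N -> exists x : G -> R,
  [/\ forall v, 0 <= x v, exists v, x v != 0 &
      forall v, slap x v = q_radius R G * x v].
Proof.
move=> G0; have [[c c0 cq] maxq] := q_radius_max G0.
pose x v := `|fun_of_row c v|; exists x; split=> [v||]; first exact: normr_ge0.
  have [i ci] : exists i, c 0 i != 0.
    apply/existsP; apply: contraR c0; rewrite negb_exists => /forallP h.
    by apply/eqP/rowP => i; rewrite mxE; apply/eqP; move: (h i); rewrite negbK.
  by exists (enum_val i); rewrite /x /fun_of_row enum_valK normr_eq0.
apply: q_radius_attained => //; apply/eqP; rewrite eq_le q_radius_ge_form //=.
have -> : \sum_v x v ^+ 2 = \sum_v fun_of_row c v ^+ 2.
  by apply: eq_bigr => v _; rewrite /x real_normK ?num_real.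
have -> : q_radius R G * \sum_v fun_of_row c v ^+ 2 = slap_form (fun_of_row c).
  rewrite -bilin1_row_of -bilin_row_of fun_of_rowK [RHS]bilinE cq bilin1.
  by rewrite big_distrr; apply: eq_bigr => i _; rewrite mxE /= mulrA.
rewrite -(@ler_pM2l _ 2) // !slap_form_edges; apply: ler_sum => v _.
apply: ler_sum => w _; rewrite -[leLHS]real_normK ?num_real //.
by rewrite lerXn2r ?nnegrE ?addr_ge0 ?normr_ge0 ?ler_normD.
Qed.
End SignlessLaplacian.

(** * Monotonicity of q under spanning subgraphs *)

Section Homomorphisms.
Variable R : realType.

Lemma sum_sqr_gt0 (T : finType) (x : T -> R) :
  (exists v, x v != 0) -> 0 < \sum_v x v ^+ 2.
Proof.
case=> v xv; rewrite (bigD1 v) //= ltr_pwDl ?sumr_ge0 // => [|w _].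
  by rewrite exprn_even_gt0.
exact: sqr_ge0.
Qed.

Variables (G H : sgraph) (f : G -> H) (g : H -> G).
Hypotheses (fK : cancel f g) (gK : cancel g f) (G0 : (0 < #|G|)%N).
Hypothesis f_hom : forall v w, adj v w -> adj (f v) (f w).

Let f_bij : bijective f. Proof. by exists g. Qed.

Lemma slap_form_transport (x : G -> R) : slap_form (x \o g : H -> R) =
  \sum_v \sum_(w | adj (f v) (f w)) x v * (x v + x w).
Proof.
rewrite slap_formE (reindex f) /=; last exact: onW_bij.
apply: eq_bigr => v _; rewrite (reindex f) /=; last exact: onW_bij.
by apply: eq_bigr => w _; rewrite !fK.
Qed.

Lemma slap_form_extra (x : G -> R) : slap_form (x \o g : H -> R) =
  slap_form x +
  \sum_v \sum_(w | adj (f v) (f w) && ~~ adj v w) x v * (x v + x w).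
Proof.
rewrite slap_form_transport slap_formE -big_split; apply: eq_bigr => v _ /=.
rewrite (bigID (adj v)) /=; congr (_ + _); apply: eq_bigl => w.
by case: (boolP (adj v w)) => [/f_hom->|_]; rewrite ?andbF.
Qed.

Lemma sum_sqr_transport (x : G -> R) :
  \sum_v (x \o g : H -> R) v ^+ 2 = \sum_v x v ^+ 2.
Proof.
rewrite (reindex f) /=; last exact: onW_bij.
by apply: eq_bigr => v _; rewrite fK.
Qed.

Let H0 : (0 < #|H|)%N. Proof. by rewrite -(bij_eq_card f_bij). Qed.

Lemma slap_form_perron (x : G -> R) :
  (forall v, slap x v = q_radius R G * x v) ->
  slap_form x = q_radius R G * \sum_v x v ^+ 2.
Proof.
move=> xq; rewrite /slap_form big_distrr; apply: eq_bigr => v _ /=.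
by rewrite xq; ring.
Qed.

(** The Perron vector of [G] is a test vector for [H]; the extra edges add nonnegative terms. *)
Lemma q_radius_hom : q_radius R G <= q_radius R H.
Proof.
have [x [x0 xn0 xq]] := perron_vector R G0.
have := q_radius_ge_form (x \o g) H0; rewrite sum_sqr_transport slap_form_extra.
rewrite (slap_form_perron xq) => h.
rewrite -(ler_pM2r (sum_sqr_gt0 xn0)); apply: le_trans h; rewrite lerDl.
by apply: sumr_ge0 => v _; apply: sumr_ge0 => w _; rewrite mulr_ge0 ?addr_ge0.
Qed.

(* Equality makes the transported Perron vector of [G] a Perron vector of [H]; *)
(* when it is positive an extra edge of [H] would increase the form.          *)
Lemma q_radius_hom_eq :
  (forall y : H -> R, (forall v, 0 <= y v) -> (exists v, y v != 0) ->
     (forall v, slap y v = q_radius R H * y v) -> forall v, 0 < y v) ->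
  q_radius R G = q_radius R H -> giso G H.
Proof.
move=> pos eq_q; have [x [x0 xn0 xq]] := perron_vector R G0.
have nn v w : 0 <= x v * (x v + x w) by rewrite mulr_ge0 ?addr_ge0.
pose X := \sum_v \sum_(w | adj (f v) (f w) && ~~ adj v w) x v * (x v + x w).
have X0 : 0 <= X by apply: sumr_ge0 => v _; apply: sumr_ge0 => w _.
have formH : slap_form (x \o g : H -> R) = q_radius R G * \sum_v x v ^+ 2 + X.
  by rewrite slap_form_extra (slap_form_perron xq).
have leH := q_radius_ge_form (x \o g) H0.
rewrite sum_sqr_transport -eq_q formH in leH.
have Xz : X = 0 by lra.
have xpos v : 0 < x v.
  rewrite -(fK v); apply: (pos (x \o g)) => [w||w]; first exact: x0.
    by have [w xw] := xn0; exists (f w); rewrite /= fK.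
  by apply: q_radius_attained => //; rewrite formH Xz addr0 eq_q sum_sqr_transport.
exists f; split=> // v w; apply/idP/idP; last exact: f_hom.
move=> fvw; apply/negPn/negP => vw.
have : 0 < X.
  rewrite /X (bigD1 v) //= (bigD1 w) ?fvw //= -addrA ltr_pwDl //.
    by rewrite mulr_gt0 ?addr_gt0.
  by rewrite addr_ge0 ?sumr_ge0 // => u _; rewrite sumr_ge0.
by rewrite Xz ltxx.
Qed.
End Homomorphisms.

Lemma q_radius_giso (R : realType) (G H : sgraph) : (0 < #|G|)%N ->
  giso G H -> q_radius R G = q_radius R H.
Proof.
move=> G0 [f [[g fK gK] fadj]].
apply/eqP; rewrite eq_le (q_radius_hom R fK gK) // => [|v w]; last by rewrite fadj.
have H0 : (0 < #|H|)%N by rewrite -(bij_eq_card (Bijective fK gK)).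
by rewrite (q_radius_hom R gK fK) // => v w; rewrite -fadj !gK.
Qed.

(** * Perron vectors and a lower bound for the extremal graph *)

Section Extremal.
Variables (R : realType) (m : nat).
Hypothesis m2 : (2 < m)%N.
Let H := graph_join (complete_graph 2) (path_graph m).

Lemma card_extremal : #|H| = m.+2.
Proof. by rewrite card_sum !card_ord. Qed.

(** A zero of a nonnegative eigenvector spreads to all neighbours, and a vertex of K_2 is adjacent
    to all others. *)
Lemma extremal_perron_pos (q : R) (y : H -> R) : (forall v, 0 <= y v) ->
  (exists v, y v != 0) -> (forall v, slap y v = q * y v) -> forall v, 0 < y v.
Proof.
move=> y0 [u yu] yq v; rewrite lt0r y0 andbT; apply: contraNneq yu => yv.
have nbr a b : y a = 0 -> adj a b -> y b = 0.
  move=> ya ab; have /eqP := yq a; rewrite /slap ya !mulr0 add0r.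
  by rewrite psumr_eq0 // => /allP/(_ b (mem_index_enum b)); rewrite ab => /eqP.
have [i yi] : exists i, y (inl i) = 0.
  case: v yv => [i|j] yv; first by exists i.
  by exists ord0; apply: nbr yv _.
have inr0 j : y (inr j) = 0 by apply: nbr yi _.
case: u => [k|j]; last by rewrite inr0.
have [->|ki] := eqVneq k i; first by rewrite yi.
by rewrite (nbr _ (inl k) yi) //= /complete_adj eq_sym.
Qed.

Lemma path_edges : (\sum_(i < m) \sum_(j < m) path_adj i j = 2 * (m - 1))%N.
Proof.
have half : (\sum_(i < m) \sum_(j < m) (j.+1 == i :> nat) = m - 1)%N.
  case: m m2 => // k _; rewrite subn1 big_ord_recl big1 // add0n.
  rewrite -[RHS]card_ord -sum1_card; apply: eq_bigr => i _.
  rewrite (bigD1 (widen_ord (leqnSn k) i)) //= eqxx big1 // => j ji.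
  apply/eqP; rewrite eqb0; apply: contra ji => /eqP ji; apply/eqP/val_inj => /=.
  by move: ji; rewrite /bump /=; lia.
transitivity (\sum_(i < m) \sum_(j < m) (i.+1 == j :> nat) +
   \sum_(i < m) \sum_(j < m) (j.+1 == i :> nat))%N; last first.
  by rewrite [X in (X + _)%N]exchange_big /= half; lia.
rewrite -big_split; apply: eq_bigr => i _; rewrite -big_split; apply: eq_bigr => j _.
by rewrite /path_adj /=; lia.
Qed.

Lemma extremal_form (s : R) :
  slap_form (fun v : H => if v is inl _ then 1 else s) =
  4 + 2 * m%:R * (1 + s) ^+ 2 + 4 * (m - 1)%:R * s ^+ 2.
Proof.
set y := (fun v : H => _).
have left_vertex i : \sum_(w | adj (inl i : H) w) y (inl i) * (y (inl i) + y w)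
    = 2 + m%:R * (1 + s).
  rewrite big_sumType /= !sumr_const card_ord mul1r -(mulr_natl (1 * (1 + s))) mul1r.
  congr (_ + _); rewrite -mulr_natl (_ : #|_| = 1%N); first by ring.
  transitivity #|predC1 i|; first by apply: eq_card => k; rewrite !inE /complete_adj eq_sym.
  by rewrite cardC1 card_ord.
have right_vertex j : \sum_(w | adj (inr j : H) w) y (inr j) * (y (inr j) + y w)
    = 2 * (s * (s + 1)) + (\sum_k path_adj j k)%:R * (2 * s ^+ 2).
  rewrite big_sumType /= sumr_const card_ord mulr_natl; congr (_ + _).
  rewrite big_mkcond natr_sum big_distrl; apply: eq_bigr => k _ /=.
  by case: path_adj; rewrite ?mul0r //=; ring.
rewrite slap_formE big_sumType /= (eq_bigr _ (fun i _ => left_vertex i)).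
rewrite (eq_bigr _ (fun j _ => right_vertex j)) !big_split /= !sumr_const !card_ord.
rewrite -mulr_suml -natr_sum path_edges natrM -(mulr_natl (2 * (s * (s + 1))) m).
by ring.
Qed.

Lemma extremal_q_radius : (m.+2%:R + 2 : R) < q_radius R H.
Proof.
pose M : R := m%:R.
have M2 : 2 < M by rewrite ltr_nat.
have Dpos : 0 < M ^+ 2 - 2 * M + 4 by nra.
(* The maximiser of [4 M s - (M ^ 2 - 2 M + 4) s ^ 2].                        *)
pose s : R := 2 * M / (M ^+ 2 - 2 * M + 4).
have sD : s * (M ^+ 2 - 2 * M + 4) = 2 * M by rewrite /s mulfVK // lt0r_neq0.
have s0 : 0 < s by rewrite divr_gt0 //; lra.
have := q_radius_ge_form (G := H) (fun v : H => if v is inl _ then 1 else s : R).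
rewrite card_extremal => /(_ isT); rewrite extremal_form big_sumType /= !sumr_const.
rewrite !card_ord expr1n -[s ^+ 2 *+ m]mulr_natl natrB ?(ltnW (ltnW m2)) // -/M => h.
have -> : (m.+2)%:R = M + 2 :> R by rewrite -addn2 natrD.
rewrite ltNge; apply/negP => q.
have : q_radius R H * (1 *+ 2 + M * s ^+ 2) <= (M + 2 + 2) * (2 + M * s ^+ 2).
  by rewrite ler_wpM2r // addr_ge0 // mulr_ge0 ?sqr_ge0 //; lra.
move/(le_trans h); rewrite leNgt => /negP; apply.
rewrite -subr_gt0.
have -> : 4 + 2 * M * (1 + s) ^+ 2 + 4 * (M - 1) * s ^+ 2 - (M + 2 + 2) * (2 + M * s ^+ 2)
  = 4 * (M * s - 1) - s * (s * (M ^+ 2 - 2 * M + 4)) by ring.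
rewrite sD.
(* As M > 2, the denominator of [s] is below M^2, so M s > 2; the difference to be shown positive is
   2 M s - 4. *)
have : 2 * M < s * M * M by rewrite -sD; nra.
rewrite ltr_pM2r; last by lra.
by move=> ?; lra.
Qed.
End Extremal.

(** * The extremal graph *)

Section Hubs.
Variables (R : realType) (G : sgraph).
Hypotheses (planarG : planar R G) (n456 : (456 <= #|G|)%N).
Hypothesis q_large : #|G|%:R + 2 <= q_radius R G.

Let n : R := #|G|%:R.
Let nge : 456 <= n. Proof. by rewrite ler_nat. Qed.

Lemma degree_le (v : G) : (degree v)%:R <= n - 1.
Proof.
have : (degree v < #|G|)%N.
  rewrite /degree -[#|G|]cardsT; apply: proper_card; apply/properP; split.
    by apply/fintype.subsetP => y; rewrite inE.
  by exists v; rewrite ?inE // adj_irrefl.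
by rewrite -(ler_nat R) -natr1 /n; lra.
Qed.

(** A third vertex has at most the average degree of itself and the two largest. *)
Lemma two_largest : exists a b : G, a != b /\
  forall c, c != a -> c != b -> (3 * degree c <= 2 * #|G| + 2)%N.
Proof.
have [a0 _] : exists a0 : G, true.
  by have /card_gt0P[a0 _] : (0 < #|G|)%N by lia; exists a0.
pose a := [arg max_(v > a0) degree v]%N.
have maxa (v : G) : (degree v <= degree a)%N.
  by rewrite /a; case: arg_maxnP => // i _ h; exact: h.
have [b0 b0a] : exists b0 : G, b0 != a.
  have : (0 < #|[set~ a]%SET|)%N by rewrite cardsC1; lia.
  by case/card_gt0P => b0; rewrite !inE => ba; exists b0.
pose b := [arg max_(v > b0 | v != a) degree v]%N.
have [ba maxb] : b != a /\ forall v : G, v != a -> (degree v <= degree b)%N.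
  by rewrite /b; case: arg_maxnP => // i ia h; split.
exists a, b; rewrite eq_sym; split=> // c ca cb.
have := planar_three_degrees planarG (a := a) (b := b) (c := c).
rewrite /= !inE negb_or !(eq_sym _ c) ca cb eq_sym ba => /(_ isT).
by have := maxa b; have := maxb c ca; lia.
Qed.

(* Let [T] be the sum of the entries of a Perron vector [x]. A vertex [c] other *)
(* than the two of largest degree has degree at most (2n + 2) / 3, whence     *)
(* x c <= 3 T / (n + 4), and such vertices contribute at most 24 T to the sum *)
(* of d(v) x v, which equals q T / 2. This leaves 9 T < 20 (x a + x b), and   *)
(* then the eigenvalue equations at [a] and [b] force both degrees.           *)
Theorem two_hubs : exists a b : G, [/\ a != b, degree a = #|G|.-1 & degree b = #|G|.-1].
Proof.
have G0 : (0 < #|G|)%N by lia.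
have [x [x0 xn0 xq]] := perron_vector R G0.
have ql : n + 2 <= q_radius R G := q_large.
set q := q_radius R G in ql xq.
pose T := \sum_v x v.
have Tpos : 0 < T.
  rewrite /T; have [v xv] := xn0; rewrite (bigD1 v) //= ltr_pwDl ?sumr_ge0 //.
  by rewrite lt0r xv x0.
have qT : q * T = 2 * \sum_v (degree v)%:R * x v.
  rewrite /T big_distrr /= (eq_bigr _ (fun v _ => esym (xq v))) /slap big_split /=.
  rewrite (exchange_big_dep xpredT) //= [X in _ + X](_ : _ = \sum_v (degree v)%:R * x v).
    by ring.
  apply: eq_bigr => v _; rewrite sumr_const -[LHS]mulr_natl; congr (_ * _).
  congr (_%:R); rewrite /degree.
  by apply: eq_card => w; rewrite !inE adj_sym.
have local (v : G) : (q - (degree v)%:R + 1) * x v <= T.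
  have -> : (q - (degree v)%:R + 1) * x v = x v + \sum_(w | adj v w) x w.
    by rewrite !mulrDl mulNr -xq /slap; ring.
  rewrite /T [leRHS](bigD1 v) //= lerD2l [leRHS](bigID (adj v)) /=.
  rewrite [X in _ <= X + _](_ : _ = \sum_(w | adj v w) x w).
    by rewrite lerDl sumr_ge0.
  by apply: eq_bigl => w; case: eqVneq => [->|]; rewrite ?adj_irrefl ?andbT.
have dn v := degree_le v.
have [a [b [ab small]]] := two_largest.
have others : \sum_(c | (c != a) && (c != b)) (degree c)%:R * x c <= 24 * T.
  (* Here q - d(c) + 1 >= n + 3 - (2n + 2) / 3 = (n + 7) / 3. *)
  have xc (c : G) : c != a -> c != b -> (n + 4) * x c <= 3 * T.
    move=> ca cb; have := small c ca cb; rewrite -(ler_nat R) !natrD -/n => dc.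
    have := local c; have := x0 c; nra.
  have sum8 : \sum_(c | (c != a) && (c != b)) (degree c)%:R <= 8 * n.
    have := planar_degree_sum planarG G0; rewrite -(ltr_nat R) natrM natr_sum => /ltW.
    apply: le_trans; rewrite [leRHS](bigID (fun c => (c != a) && (c != b))) /=.
    by rewrite lerDl sumr_ge0.
  have h : (n + 4) * \sum_(c | (c != a) && (c != b)) (degree c)%:R * x c <= 3 * T * (8 * n).
    apply: le_trans (ler_wpM2l _ sum8); last by lra.
    rewrite [leLHS]mulr_sumr [leRHS]mulr_sumr; apply: ler_sum => c /andP[ca cb].
    rewrite mulrCA [leRHS]mulrC; apply: ler_wpM2l => //; exact: xc.
  rewrite -(@ler_pM2l _ (n + 4)); last by have := nge; lra.
  by apply: le_trans h _; nra.
(* From (n + 2) T <= 2 (n - 1) (x a + x b) + 48 T, using 18 (n - 1) < 20 (n - 46) for n >= 456. *)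
have Tle : 9 * T < 20 * (x a + x b).
  have : (n - 46) * T <= 2 * (n - 1) * (x a + x b).
    have : q * T <= 2 * ((n - 1) * x a + ((n - 1) * x b + 24 * T)).
      rewrite qT ler_pM2l // (bigD1 a) //= (bigD1 b) ?(eq_sym b) //=.
      by rewrite !lerD // ?ler_wpM2r //.
    by nra.
  have n46 : 0 < n - 46 by have := nge; lra.
  have n1 : 0 < 2 * (n - 1) by have := nge; lra.
  move: (x a + x b) => y h.
  have y0 : 0 < y by rewrite -(pmulr_rgt0 _ n1); apply: lt_le_trans h; rewrite mulr_gt0.
  rewrite -subr_gt0 -(pmulr_rgt0 _ n46).
  by have := nge; nra.
(* By [local], degree at most n - 2 gives 5 x <= T, and degree n - 1 gives 4 x <= T. The first fails
   at [u], as 9 T < 40 x u; at [v] it would give 20 (x u + x v) <= 5 T + 4 T. *)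
have hub (u v : G) : x v <= x u -> 9 * T < 20 * (x u + x v) ->
    degree u = #|G|.-1 /\ degree v = #|G|.-1.
  move=> vu Tuv; have xu : 0 < x u by have := x0 v; nra.
  have full (w : G) : (n - 2 < (degree w)%:R) -> degree w = #|G|.-1.
    move=> h; have := dn w.
    have : (#|G| < degree w + 2)%N by rewrite -(ltr_nat R) natrD -/n; lra.
    have -> : n - 1 = (#|G|.-1)%:R by rewrite -subn1 natrB.
    by rewrite ler_nat; lia.
  have du : n - 2 < (degree u)%:R.
    rewrite ltNge; apply/negP => h; have := local u.
    by nra.
  split; apply: full => //; rewrite ltNge; apply/negP => h.
  have h1 := local u; have h2 := local v; have dun := dn u.
  have : 4 * x u <= T by nra.
  have : 5 * x v <= T by have := x0 v; nra.
  nra.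
have [xab|xba] := leP (x b) (x a).
  by have [da db] := hub a b xab Tle; exists a, b.
have [db da] := hub b a (ltW xba) ltac:(by rewrite [x b + x a]addrC).
by exists a, b.
Qed.
End Hubs.

(** * Embedding a graph with two hubs *)

Section Embedding.
Variables (R : realType) (G : sgraph) (a b : G).
Hypotheses (planarG : planar R G) (n456 : (456 <= #|G|)%N) (ab : a != b).
Hypotheses (da : degree a = #|G|.-1) (db : degree b = #|G|.-1).

Lemma hub_adj (u y : G) : degree u = #|G|.-1 -> y != u -> adj u y.
Proof.
move=> du yu; suff /(_ y) : [pred y | adj u y] =i predC1 u.
  by rewrite !inE yu.
apply/subset_cardP; first by rewrite -/(degree u) du cardC1.
apply/fintype.subsetP => z; rewrite !inE => uz.
by apply: contraTneq uz => ->; rewrite adj_irrefl.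
Qed.

Let A : {set G} := [set~ a]%SET :\ b.

(** The two hubs, as singleton branch sets, would complete a triangle minor to K_5. *)
Lemma hubs_no_K3 B : ~ clique_model (@adj G) A 3 B.
Proof.
move=> KA; apply: (planar_no_K5_model planarG (A := [set: G]%SET)).
apply: (clique_modelS (N := b |: A) (v := a)) => [||y|].
- exact: finset.subsetT.
- by rewrite inE.
- rewrite /A !inE => ya; have {}ya : y != a.
    by case: (eqVneq y a) ya => // ->; rewrite (negbTE ab) andbF.
  by rewrite hub_adj // eq_sym.
apply: (clique_modelS (N := A) (v := b)) => [||y|].
- exact: finset.subsetUr.
- by rewrite !inE eqxx.
- by rewrite /A !inE => /andP[yb _]; rewrite hub_adj // eq_sym.
- exact: KA.
Qed.

(** Three neighbours of [y] in [A], against [y] and the two hubs, would form K_{3,3}. *)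
Lemma hubs_deg2 : {in A, forall y, (deg_in (@adj G) A y <= 2)%N}.
Proof.
move=> y yA; rewrite deg_in_card leqNgt; apply/negP => d3.
move: yA; rewrite /A !inE => /andP[yb ya].
apply: (planar_no_K33 planarG (s := [:: y; a; b])
  (t := take 3 (enum [set z in A | adj y z]%SET))) => //.
- by rewrite size_takel // -cardE.
- by rewrite /= !inE negb_or ya yb ab.
- by rewrite take_uniq ?enum_uniq.
move=> x z xs /mem_take; rewrite mem_enum !inE => /andP[/andP[zb za] yz].
by move: xs; rewrite !inE => /or3P[]/eqP-> //; apply: hub_adj.
Qed.

Let H := graph_join (complete_graph 2) (path_graph (#|G| - 2)).

Lemma card_rest : #|A| = (#|G| - 2)%N.
Proof.
have := finset.cardsD1 b [set~ a]%SET; rewrite -/A cardsC1 !inE eq_sym ab.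
by lia.
Qed.

Lemma hubs_embedding : exists (f : G -> H) (g : H -> G),
  [/\ cancel f g, cancel g f & forall v w, adj v w -> adj (f v) (f w)].
Proof.
have A0 : A != finset.set0 by rewrite -card_gt0 card_rest; lia.
have [x xA dx] := low_degree_vertex (@adj_sym G) (@adj_irrefl G) A0 hubs_no_K3.
have [s [us sA adj_s]] :=
  linear_forest_enum (@adj_sym G) (@adj_irrefl G) hubs_no_K3 hubs_deg2 xA dx.
pose l := x :: s; have sz : size l = (#|G| - 2)%N.
  by rewrite -card_rest -(eq_card sA); apply/esym/card_uniqP.
have m0 : (0 < #|G| - 2)%N by lia.
(* The default [Ordinal m0] occurs only for the hubs, whose index is out of range. *)
pose pos v : 'I_(#|G| - 2) := insubd (Ordinal m0) (index v l).
have posE v : v \in A -> pos v = index v l :> nat.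
  move=> vA; rewrite /pos val_insubd (_ : (_ < _)%N = true) //.
  by rewrite -sz index_mem sA vA.
have memA v : v != a -> v != b -> v \in A by move=> va vb; rewrite /A !inE va vb.
pose f v : H := if v == a then inl ord0 else
  if v == b then inl (lift ord0 ord0) else inr (pos v).
have ba : (b == a) = false by rewrite eq_sym (negbTE ab).
have f_inj : injective f.
  move=> v w; rewrite /f.
  have [->|va] := eqVneq v a; have [->|wa] := eqVneq w a => //.
  - by case: eqVneq.
  - by case: eqVneq.
  have [->|vb] := eqVneq v b; have [->|wb] := eqVneq w b => //.
  move=> [/(congr1 val)] /=; rewrite !posE ?memA // => /(congr1 (nth x l)).
  by rewrite !nth_index ?sA ?memA.
have cGH : #|H| = #|G| by rewrite card_sum !card_ord; lia.
have [g fK gK] : bijective f by apply: inj_card_bij f_inj _; rewrite cGH.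
exists f, g; split=> // v w vw; rewrite /f.
have [va|va] := eqVneq v a; have [wa|wa] := eqVneq w a.
- by rewrite va wa adj_irrefl in vw.
- by case: eqVneq.
- by case: eqVneq.
have [vb|vb] := eqVneq v b; have [wb|wb] := eqVneq w b => //.
  by rewrite vb wb adj_irrefl in vw.
rewrite /= /path_adj !posE ?memA //.
have [->|->] := adj_s v w (memA v va vb) (memA w wa wb) vw; by rewrite eqxx ?orbT.
Qed.
End Embedding.

Theorem theorem3p15 (R : realType) (n : nat) (G : sgraph)
    (hn : (456 <= n)%N) (hG : #|G| = n) (hplanar : planar R G) :
  let H := graph_join (complete_graph 2) (path_graph (n - 2)) in
  q_radius R G <= q_radius R H /\
  (q_radius R G = q_radius R H <-> giso G H).
Proof.
subst n; set H := graph_join _ _ => /=.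
have G0 : (0 < #|G|)%N by lia.
have iso_eq := @q_radius_giso R G H G0.
(* If q(G) < q(H), equality and isomorphism both fail; otherwise q(G) is large enough to force two
   hubs. *)
have [lt_q|le_q] := ltP (q_radius R G) (q_radius R H).
  by split; [exact: ltW|split=> [eq_q|/iso_eq//]; rewrite eq_q ltxx in lt_q].
have m2 : (2 < #|G| - 2)%N by lia.
have q_large : #|G|%:R + 2 <= q_radius R G.
  apply: le_trans le_q; have := extremal_q_radius R m2.
  by rewrite (_ : (#|G| - 2).+2 = #|G|); [exact: ltW|lia].
have [a [b [ab da db]]] := two_hubs hplanar hn q_large.
have [f [g [fK gK f_hom]]] := hubs_embedding hplanar hn ab da db.
have GH := q_radius_hom R fK gK G0 f_hom.
split=> //; split=> // eq_q.
apply: (q_radius_hom_eq fK gK G0 f_hom) eq_q => y.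
exact: extremal_perron_pos.
Qed.
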